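(* Let $\{\lambda_n\}_{n=0}^\infty$ be the eigenvalues of the non-local boundary value problem $$-\phi''=\lambda\phi \ \text{ on } (0,1),\qquad \phi(0)+\phi(1)=-\phi'(0)=\phi'(1),$$ and let $K_p(x,y)$ be the $p$-th iterated kernel of $K(x,y)=-|x-y|/2$ on $[0,1]\times[0,1]$. Then $$A_p=\sum_{n=0}^\infty\frac{1}{\lambda_n^p}=\int_0^1K_p(x,x)\,dx$$ satisfies the recursion formula $$4A_{p+1}+\sum_{k=1}^{p-1}(-1)^k\left(\frac{2}{(2k)!}-\frac{1}{(2k-1)!}\right)A_{p-k+1}=\frac{(-1)^{p+1}\,p}{(2p+1)!},\qquad p=1,2,\ldots,$$ with $A_1=0$.
   Context: The eigenvalues $\{\lambda_n\}_{n\ge 0}$ are explicitly the following (each listed once): $\lambda_0<0$ is the only negative eigenvalue ($\lambda_0\approx-5.756915$) and is the solution of $\coth\frac{\sqrt{-\lambda_0}}{2}=\frac{\sqrt{-\lambda_0}}{2}$; $\lambda_{2m-1}=(2m-1)^2\pi^2$ for $m=1,2,\ldots$; and, for $m=1,2,\ldots$, $\lambda_{2m}>0$ is the $m$-th positive solution of $\cot\frac{\sqrt{\lambda_{2m}}}{2}=-\frac{\sqrt{\lambda_{2m}}}{2}$. The corresponding eigenfunctions are those of the integral operator on $L^2(0,1)$ with kernel $K(x,y)$, whose eigenvalues are $1/\lambda_n$. The iterated kernels are defined by $K_1=K$ and $K_{p+1}(x,y)=\int_0^1K_p(x,z)K(z,y)\,dz$ for $p\ge1$. For $p=1$ the sum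 over $k$ in the recursion is empty. *)

(* Defs.v *)
From Stdlib Require Import Reals Factorial.
From Coquelicot Require Import Coquelicot.

Open Scope R_scope.

Definition I01 (x : R) : Prop := 0 <= x <= 1.

(* [D_in f df D x] is differentiability at [x] relative to [D], with value
   [df x]: with [D := I01] it is one-sided at 0 and 1, so that [dphi 0] and
   [dphi 1] are the boundary derivatives and the values of [phi] and [dphi]
   outside [0,1] are irrelevant. *)
Definition is_eigenfunction (lambda : R) (phi : R -> R) : Prop :=
  (exists x, I01 x /\ phi x <> 0) /\
  exists dphi : R -> R,
    (forall x, I01 x -> D_in phi dphi I01 x) /\
    (forall x, 0 < x < 1 ->
       ex_derive dphi x /\ - Derive dphi x = lambda * phi x) /\
    phi 0 + phi 1 = - dphi 0 /\
    - dphi 0 = dphi 1.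

Definition is_eigenvalue (lambda : R) : Prop :=
  exists phi : R -> R, is_eigenfunction lambda phi.

(* Each eigenvalue is listed exactly once, in any order. *)
Definition enumerates_eigenvalues (lambda : nat -> R) : Prop :=
  (forall m n, lambda m = lambda n -> m = n) /\
  (forall mu, is_eigenvalue mu <-> exists n, lambda n = mu).

Definition K (x y : R) : R := - Rabs (x - y) / 2.

(* [iter_kernel p] is K_p for p >= 1; the value at p = 0 is a dummy. *)
Fixpoint iter_kernel (p : nat) (x y : R) : R :=
  match p with
  | O => 0
  | S q =>
      match q with
      | O => K x y
      | S _ => RInt (fun z => iter_kernel q x z * K z y) 0 1
      end
  end.

Definition A (lambda : nat -> R) (p : nat) : R :=
  Series (fun n => 1 / lambda n ^ p).

(* Main.v *)
Require Import Defs.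
From Stdlib Require Import Reals Factorial Lra Lia Arith List Permutation.
From Coquelicot Require Import Coquelicot.

Open Scope R_scope.

(** Let D(l) = (1 + cos w)/2 + (w sin w)/4 with l = w^2. It is entire in l, its
    Taylor coefficients are [char_coef], with D(0) = 1, and 4 D(l) is the
    determinant of the boundary conditions, so that the eigenvalues are the zeros
    of D. If D is the product of the factors 1 - l/l_n, then taking the
    logarithmic derivative gives
      d_0 s_(q+1) + ... + d_q s_1 = - (q+1) d_(q+1)
    for the power sums s_p of the 1/l_n (Newton's identities), and this is the
    asserted recursion: 4 d_k and 4 (p+1) d_(p+1) are its coefficients and its
    right-hand side up to sign, and s_1 = - d_1 = 0. Since d_0 = 1, these
    identities determine all s_p. It therefore suffices to prove them twice, for
    the traces of the iterated kernels and for the sums of 1/l_n^p; the trace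
    formula then needs no expansion in eigenfunctions.

    Traces. D(l) times the resolvent kernel of K has the elementary closed form
      8 N = - 2 sin(w r)/w + 2 sin(w(1-r))/w - cos(w(1-r)) - cos(w(x+y-1)),
    with r = |x-y|. Comparing coefficients of l^q gives
    N_q = d_0 K_(q+1) + ... + d_q K_1 ([iter_kernel_spec]). The induction step
    N_(q+1) = d_(q+1) K + int N_q K is Green's formula [is_RInt_K_bvp], because
    N_(q+1) - d_(q+1) K satisfies the boundary conditions and has second
    derivative - N_q. Integrating N_q over the diagonal gives
    [newton_sum_trace].

    Eigenvalues. The product formula for D is replaced by a finite one. With
    N = n + 1, M = 2 N and l = 2 M^2 (1 - cos t), the polynomial
      D_n(l) = (1 + T_M)/2 + (M/8) (T_(M-1) - T_(M+1))
    in cos t equals cos(N t) (cos(N t) + N sin t sin(N t)). So the intermediate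
    value theorem locates its M + 1 roots, one of them for imaginary t; they
    exhaust its degree, and
    [prod_coef_disc] writes D_n as the product over them. Newton's identities
    hold for these finite products. As n grows, the coefficients of D_n tend to
    those of D ([is_lim_seq_disc_coef]), each root tends to an eigenvalue, and
    the i-th positive root is at least i^2/9, so the power sums converge to those of the
    eigenvalues by dominated convergence of series ([tannery]); the identities
    pass to the limit ([newton_sum_eigenvalues]). The sums do not depend on the
    order in which the eigenvalues are listed, by absolute convergence
    ([is_series_rearrange]). *)

(** * Taylor coefficients of the characteristic function *)

(** Finite sums are typed in an abstract monoid; [ring] and [field] only see the
    field of real numbers once the equality is retyped. *)
Ltac eqR := match goal with |- ?a = ?b => change (@eq R a b) end.

(** Taylor coefficients in l of (1 + cos w)/2 + (w sin w)/4, l = w^2; the first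
    summand is the constant 1/2. *)
Definition char_coef (k : nat) : R :=
  (if Nat.eqb k 0 then / 2 else 0)
  + (-1) ^ k * (1 - INR k) / (2 * INR (fact (2 * k))).

Lemma char_coef_0 : char_coef 0 = 1.
Proof. unfold char_coef; simpl; field. Qed.

Lemma INR_fact_S (n : nat) : INR (fact (S n)) = (INR n + 1) * INR (fact n).
Proof. rewrite fact_simpl, mult_INR, S_INR; reflexivity. Qed.

(** The form in which these coefficients enter the recursion for the A_p. *)
Lemma char_coef_S (k : nat) :
  4 * char_coef (S k) =
  (-1) ^ S k * (2 / INR (fact (2 * S k)) - 1 / INR (fact (2 * S k - 1))).
Proof.
  unfold char_coef; simpl Nat.eqb; cbv iota.
  replace (2 * S k)%nat with (S (S (2 * k))) by lia.
  replace (S (S (2 * k)) - 1)%nat with (S (2 * k)) by lia.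
  rewrite !INR_fact_S, !S_INR, !mult_INR; simpl (INR 2).
  pose proof (INR_fact_neq_0 (2 * k)); pose proof (pos_INR k).
  field; repeat split; lra || assumption.
Qed.

(** * The integral operator inverts the boundary value problem *)

(** The kernels have a kink on the diagonal; gluing the one-sided formulas is how
    differentiability there is checked. *)
Lemma is_derive_glue (a b : R -> R) (c l : R) :
  is_derive a c l -> is_derive b c l -> a c = b c ->
  is_derive (fun t => if Rlt_dec t c then a t else b t) c l.
Proof.
  intros Ha Hb Hab.
  apply is_derive_Reals in Ha; apply is_derive_Reals in Hb; apply is_derive_Reals.
  intros eps He.
  destruct (Ha eps He) as [d1 H1]; destruct (Hb eps He) as [d2 H2].
  assert (Hd : 0 < Rmin d1 d2) by (apply Rmin_pos; apply cond_pos).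
  exists (mkposreal _ Hd); intros h Hh0 Hh; simpl in Hh.
  destruct (Rlt_dec c c); [lra|].
  destruct (Rlt_dec (c + h) c).
  - rewrite <- Hab; apply H1; auto.
    eapply Rlt_le_trans; [exact Hh|apply Rmin_l].
  - apply H2; auto; eapply Rlt_le_trans; [exact Hh|apply Rmin_r].
Qed.

Definition even_ext (h : R -> R) (t : R) : R := h (Rabs t).
Definition odd_ext (h : R -> R) (t : R) : R := if Rlt_dec t 0 then - h (- t) else h t.

(** A kink of h(|t|) at 0 can only come from h'(0). *)
Lemma is_derive_even_ext (h h' : R -> R) (t : R) :
  (forall r, is_derive h r (h' r)) -> h' 0 = 0 ->
  is_derive (even_ext h) t (odd_ext h' t).
Proof.
  intros Hd H0; unfold odd_ext.
  assert (Hn : forall s, is_derive (fun s => h (- s)) s (- h' (- s))).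
  { intros s; auto_derive. eexists; apply Hd.
    rewrite (is_derive_unique (fun x : R => h x) _ _ (Hd (- s))); ring. }
  apply is_derive_ext with (fun t => if Rlt_dec t 0 then h (- t) else h t).
  { intros s; unfold even_ext; destruct (Rlt_dec s 0).
    now rewrite Rabs_left. rewrite Rabs_pos_eq; auto; lra. }
  destruct (Rtotal_order t 0) as [Ht|[Ht|Ht]].
  - destruct (Rlt_dec t 0); [|lra].
    apply is_derive_ext_loc with (fun s => h (- s)); [|apply Hn].
    exists (mkposreal (- t) ltac:(lra)); intros s Hs.
    destruct (Rlt_dec s 0); auto.
    unfold ball in Hs; simpl in Hs; unfold AbsRing_ball, abs, minus, plus, opp in Hs; simpl in Hs.
    apply Rabs_lt_between in Hs; lra.
  - subst t; destruct (Rlt_dec 0 0); [lra|]; rewrite H0.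
    apply (is_derive_glue (fun s => h (- s)) h).
    + replace 0 with (- h' (- 0)) at 2 by (rewrite Ropp_0, H0; ring); apply Hn.
    + rewrite <- H0 at 2; apply Hd.
    + now rewrite Ropp_0.
  - destruct (Rlt_dec t 0); [lra|].
    apply is_derive_ext_loc with h; [|apply Hd].
    exists (mkposreal t Ht); intros s Hs.
    destruct (Rlt_dec s 0); auto.
    unfold ball in Hs; simpl in Hs; unfold AbsRing_ball, abs, minus, plus, opp in Hs; simpl in Hs.
    apply Rabs_lt_between in Hs; lra.
Qed.

Lemma is_derive_odd_ext (h h' : R -> R) (t : R) :
  (forall r, is_derive h r (h' r)) -> h 0 = 0 ->
  is_derive (odd_ext h) t (even_ext h' t).
Proof.
  intros Hd H0; unfold even_ext.
  assert (Hn : forall s, is_derive (fun s => - h (- s)) s (h' (- s))).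
  { intros s; auto_derive. eexists; apply Hd.
    rewrite (is_derive_unique (fun x : R => h x) _ _ (Hd (- s))); ring. }
  destruct (Rtotal_order t 0) as [Ht|[Ht|Ht]].
  - rewrite Rabs_left by lra.
    apply is_derive_ext_loc with (fun s => - h (- s)); [|apply Hn].
    exists (mkposreal (- t) ltac:(lra)); intros s Hs.
    unfold odd_ext; destruct (Rlt_dec s 0); auto.
    unfold ball in Hs; simpl in Hs; unfold AbsRing_ball, abs, minus, plus, opp in Hs; simpl in Hs.
    apply Rabs_lt_between in Hs; lra.
  - subst t; rewrite Rabs_R0.
    apply (is_derive_glue (fun s => - h (- s)) h).
    + rewrite <- Ropp_0 at 2; apply Hn.
    + apply Hd.
    + rewrite Ropp_0, H0; ring.
  - rewrite Rabs_pos_eq by lra.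
    apply is_derive_ext_loc with h; [|apply Hd].
    exists (mkposreal t Ht); intros s Hs.
    unfold odd_ext; destruct (Rlt_dec s 0); auto.
    unfold ball in Hs; simpl in Hs; unfold AbsRing_ball, abs, minus, plus, opp in Hs; simpl in Hs.
    apply Rabs_lt_between in Hs; lra.
Qed.

Lemma is_RInt_primitive (f df : R -> R) (a b : R) :
  (forall x, is_derive f x (df x)) -> (forall x, continuous df x) ->
  is_RInt df a b (f b - f a).
Proof.
  intros Hd Hc.
  exact (is_RInt_derive (V := R_CompleteNormedModule) f df a b
    (fun x _ => Hd x) (fun x _ => Hc x)).
Qed.

Lemma continuous_of_ex_derive (f : R -> R) (x : R) : ex_derive f x -> continuous f x.
Proof. exact (ex_derive_continuous (K := R_AbsRing) (V := R_NormedModule) f x). Qed.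

Lemma continuous_Rmult (f g : R -> R) (x : R) :
  continuous f x -> continuous g x -> continuous (fun t : R => f t * g t) x.
Proof. exact (continuous_mult (U := R_UniformSpace) (K := R_AbsRing) f g x). Qed.

(** Green's formula: the kernel K inverts minus the second derivative under the
    non-local boundary conditions. Integrating by parts on both sides of y leaves
    f(y) plus boundary terms, which the two conditions cancel. *)
Lemma is_RInt_K_bvp (f f' f'' : R -> R) (y : R) : I01 y ->
  (forall z, is_derive f z (f' z)) -> (forall z, is_derive f' z (f'' z)) ->
  (forall z, continuous f'' z) ->
  f 0 + f 1 = - f' 0 -> - f' 0 = f' 1 ->
  is_RInt (fun z => - f'' z * K z y) 0 1 (f y).
Proof.
  intros [Hy0 Hy1] Hf Hf' Hc B1 B2.
  assert (L : is_RInt (fun z => - f'' z * K z y) 0 y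
     ((f' y * (y - y) / 2 + f y / 2) - (f' 0 * (y - 0) / 2 + f 0 / 2))).
  { apply is_RInt_ext with (fun z => f'' z * ((y - z) / 2)).
    { intros z; rewrite Rmin_left, Rmax_right by lra; intros Hz.
      unfold K; rewrite Rabs_left by lra; eqR; field. }
    apply (is_RInt_primitive (fun z => f' z * (y - z) / 2 + f z / 2)).
    - intros z; auto_derive.
      repeat split; eexists; eauto.
      rewrite (is_derive_unique (fun x : R => f x) _ _ (Hf z)), (is_derive_unique (fun x : R => f' x) _ _ (Hf' z)); field.
    - intros z; apply continuous_Rmult; [apply Hc|].
      apply continuous_of_ex_derive; auto_derive; auto. }
  assert (U : is_RInt (fun z => - f'' z * K z y) y 1
     ((f' 1 * (1 - y) / 2 - f 1 / 2) - (f' y * (y - y) / 2 - f y / 2))).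
  { apply is_RInt_ext with (fun z => f'' z * ((z - y) / 2)).
    { intros z; rewrite Rmin_left, Rmax_right by lra; intros Hz.
      unfold K; rewrite Rabs_pos_eq by lra; eqR; field. }
    apply (is_RInt_primitive (fun z => f' z * (z - y) / 2 - f z / 2)).
    - intros z; auto_derive.
      repeat split; eexists; eauto.
      rewrite (is_derive_unique (fun x : R => f x) _ _ (Hf z)), (is_derive_unique (fun x : R => f' x) _ _ (Hf' z)); field.
    - intros z; apply continuous_Rmult; [apply Hc|].
      apply continuous_of_ex_derive; auto_derive; auto. }
  pose proof (is_RInt_Chasles _ _ _ _ _ _ L U) as C.
  unfold plus in C; simpl in C.
  (* the terms at y add up to f(y); those at 0 and 1 vanish by the two conditions *)
  replace (f y) with
    (f' y * (y - y) / 2 + f y / 2 - (f' 0 * (y - 0) / 2 + f 0 / 2) +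
     (f' 1 * (1 - y) / 2 - f 1 / 2 - (f' y * (y - y) / 2 - f y / 2))); auto.
  rewrite <- B2; replace (f 1) with (- f' 0 - f 0) by lra; field.
Qed.

(** * Numerator of the resolvent kernel *)

(** Divided powers, so that differentiation lowers the index without a factor. *)
Definition div_pow (n : nat) (x : R) : R := x ^ n / INR (fact n).

Lemma is_derive_div_pow (n : nat) (x : R) : is_derive (div_pow (S n)) x (div_pow n x).
Proof.
  unfold div_pow.
  replace (x ^ n / INR (fact n)) with (INR (S n) * x ^ n / INR (fact (S n))).
  - generalize (INR (fact (S n))); intros c.
    auto_derive; auto. cbn [Nat.pred]; change (match n with O => 1 | S _ => INR n + 1 end) with (INR (S n)); unfold Rdiv; ring.
  - rewrite INR_fact_S, S_INR.
    pose proof (INR_fact_neq_0 n); pose proof (pos_INR n).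
    field; split; lra.
Qed.

Lemma ex_derive_div_pow (n : nat) (x : R) : ex_derive (div_pow n) x.
Proof. unfold div_pow; auto_derive; auto. Qed.

Lemma div_pow_neg_even (m : nat) (x : R) : div_pow (2 * m) (- x) = div_pow (2 * m) x.
Proof. unfold div_pow; rewrite !pow_mult; replace ((- x) ^ 2) with (x ^ 2) by ring; reflexivity. Qed.

Lemma div_pow_neg_odd (m : nat) (x : R) : div_pow (S (2 * m)) (- x) = - div_pow (S (2 * m)) x.
Proof.
  pose proof (div_pow_neg_even m x) as H; unfold div_pow in *.
  rewrite INR_fact_S, <- !tech_pow_Rmult.
  pose proof (INR_fact_neq_0 (2 * m)); pose proof (pos_INR (2 * m)).
  assert (E : (- x) ^ (2 * m) = x ^ (2 * m)).
  { rewrite !pow_mult; f_equal; ring. }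
  rewrite E; field; split; lra.
Qed.

(** The part of the coefficient of l^q in D(l) times the resolvent kernel that
    depends on r = |x-y| only. *)
Definition diff_part (q : nat) (r : R) : R :=
  (-1) ^ q / 8 *
  (- 2 * div_pow (S (2 * q)) r + 2 * div_pow (S (2 * q)) (1 - r) - div_pow (2 * q) (1 - r)).

(** Coefficient of l^q in
      (- 2 sin(w r)/w + 2 sin(w(1-r))/w - cos(w(1-r)) - cos(w(x+y-1))) / 8,
    with l = w^2 and r = |x-y|, found by solving the boundary value problem for
    the Green function of - u'' - l u and multiplying by D(l). *)
Definition resolvent_num (q : nat) (x y : R) : R :=
  diff_part q (Rabs (y - x)) - (-1) ^ q / 8 * div_pow (2 * q) (x + y - 1).

(** The correction r/2 times the coefficient of D removes the kink of the next
    [diff_part] at r = 0, since K(x,y) = - r/2; what remains is twice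
    differentiable across the diagonal. *)
Definition smooth_part (q : nat) (r : R) : R := diff_part (S q) r + char_coef (S q) * r / 2.
Definition smooth_part' (q : nat) (r : R) : R :=
  (-1) ^ S q / 8 *
  (- 2 * div_pow (2 * S q) r - 2 * div_pow (2 * S q) (1 - r) + div_pow (S (2 * q)) (1 - r))
  + char_coef (S q) / 2.

Lemma is_derive_smooth_part (q : nat) (r : R) :
  is_derive (smooth_part q) r (smooth_part' q r).
Proof.
  unfold smooth_part, diff_part, smooth_part'.
  replace (2 * S q)%nat with (S (S (2 * q))) by lia.
  generalize (2 * q)%nat; intros n.
  auto_derive.
  { repeat split; auto; eexists; apply is_derive_div_pow. }
  rewrite !(fun n x => is_derive_unique (fun x : R => div_pow (S n) x) x _ (is_derive_div_pow n x)).
  unfold Rminus; simpl ((-1) ^ _); field.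
Qed.

Lemma is_derive_smooth_part' (q : nat) (r : R) :
  is_derive (smooth_part' q) r (- diff_part q r).
Proof.
  unfold diff_part, smooth_part'.
  replace (2 * S q)%nat with (S (S (2 * q))) by lia.
  generalize (2 * q)%nat; intros n.
  auto_derive.
  { repeat split; auto; eexists; apply is_derive_div_pow. }
  rewrite !(fun n x => is_derive_unique (fun x : R => div_pow (S n) x) x _ (is_derive_div_pow n x)).
  unfold Rminus; simpl ((-1) ^ _); field.
Qed.

Lemma div_pow_S_0 (n : nat) : div_pow (S n) 0 = 0.
Proof. unfold div_pow; rewrite pow_ne_zero by lia; unfold Rdiv; ring. Qed.

(** This cancellation fixes the numbers [char_coef]. *)
Lemma smooth_part'_0 (q : nat) : smooth_part' q 0 = 0.
Proof.
  unfold smooth_part'.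
  replace (char_coef (S q) / 2) with (4 * char_coef (S q) / 8) by field.
  rewrite char_coef_S.
  replace (2 * S q)%nat with (S (S (2 * q))) by lia.
  replace (S (S (2 * q)) - 1)%nat with (S (2 * q)) by lia.
  rewrite div_pow_S_0, Rminus_0_r; unfold div_pow; rewrite !pow1; field.
  split; apply INR_fact_neq_0.
Qed.

Lemma continuous_Rabs_shift (x z : R) : continuous (fun z => Rabs (z - x)) z.
Proof.
  apply (continuous_comp (fun z => z - x) Rabs).
  - apply continuous_of_ex_derive; auto_derive; auto.
  - apply continuous_Rabs.
Qed.

Lemma ex_derive_diff_part (q : nat) (r : R) : ex_derive (diff_part q) r.
Proof. unfold diff_part; auto_derive; repeat split; apply ex_derive_div_pow. Qed.

Lemma continuous_resolvent_num (q : nat) (x z : R) : continuous (resolvent_num q x) z.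
Proof.
  unfold resolvent_num.
  apply (continuous_minus (V := R_NormedModule)
    (fun z => diff_part q (Rabs (z - x))) (fun z => (-1) ^ q / 8 * div_pow (2 * q) (x + z - 1))).
  - apply (continuous_comp (fun z => Rabs (z - x)) (diff_part q)).
    + apply continuous_Rabs_shift.
    + apply continuous_of_ex_derive, ex_derive_diff_part.
  - apply continuous_of_ex_derive; auto_derive; apply ex_derive_div_pow.
Qed.

Lemma resolvent_num_0 (x y : R) : I01 x -> I01 y -> resolvent_num 0 x y = K x y.
Proof.
  intros Hx Hy; unfold resolvent_num, diff_part, div_pow, K; simpl.
  rewrite (Rabs_minus_sym x y); field.
Qed.

(** The resolvent identity D G = D K + l (D G) K, read off at l^(q+1). *)
Lemma resolvent_num_step (q : nat) (x y : R) : I01 x -> I01 y ->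
  is_RInt (fun z => resolvent_num q x z * K z y) 0 1 (resolvent_num (S q) x y - char_coef (S q) * K x y).
Proof.
  intros [Hx0 Hx1] Hy.
  set (s := (-1) ^ S q / 8).
  set (f := fun z => even_ext (smooth_part q) (z - x) - s * div_pow (2 * S q) (x + z - 1)).
  set (f' := fun z => odd_ext (smooth_part' q) (z - x) - s * div_pow (S (2 * q)) (x + z - 1)).
  replace (resolvent_num (S q) x y - char_coef (S q) * K x y) with (f y).
  2:{ unfold f, resolvent_num, even_ext, smooth_part, K.
      rewrite (Rabs_minus_sym x y); unfold s; field. }
  apply is_RInt_ext with (fun z => - (- resolvent_num q x z) * K z y).
  { intros; eqR; ring. }
  pose proof (fun t => is_derive_even_ext _ _ t (is_derive_smooth_part q) (smooth_part'_0 q)) as D1.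
  pose proof (fun t => is_derive_odd_ext _ _ t (is_derive_smooth_part' q) (smooth_part'_0 q)) as D2.
  apply (is_RInt_K_bvp f f' (fun z => - resolvent_num q x z)); auto.
  - intros z; unfold f, f'.
    replace (2 * S q)%nat with (S (S (2 * q))) by lia.
    generalize (2 * q)%nat; intros n.
    auto_derive.
    { repeat split; eexists; [apply D1|apply is_derive_div_pow]. }
    rewrite (fun n x => is_derive_unique (fun x : R => div_pow (S n) x) x _ (is_derive_div_pow n x)).
    rewrite (is_derive_unique (fun x : R => even_ext (smooth_part q) x) _ _ (D1 _)).
    unfold Rminus; ring.
  - intros z; unfold f', resolvent_num.
    generalize (2 * q)%nat; intros n.
    auto_derive.
    { repeat split; eexists; [apply D2|apply is_derive_div_pow]. }
    rewrite (fun n x => is_derive_unique (fun x : R => div_pow (S n) x) x _ (is_derive_div_pow n x)).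
    rewrite (is_derive_unique (fun x : R => odd_ext (smooth_part' q) x) _ _ (D2 _)).
    unfold even_ext, s, Rminus; simpl ((-1) ^ S q); field.
  - intros z; apply (continuous_opp (V := R_NormedModule)), continuous_resolvent_num.
  - unfold f, f', even_ext.
    replace (odd_ext (smooth_part' q) (0 - x)) with (- smooth_part' q x).
    2:{ unfold odd_ext; destruct (Rlt_dec (0 - x) 0).
        - do 2 f_equal; ring.
        - replace (0 - x) with 0 by lra; replace x with 0 by lra.
          rewrite smooth_part'_0; ring. }
    replace (Rabs (0 - x)) with x by (rewrite Rabs_minus_sym, Rabs_pos_eq; lra).
    replace (Rabs (1 - x)) with (1 - x) by (rewrite Rabs_pos_eq; lra).
    replace (x + 0 - 1) with (- (1 - x)) by ring.
    replace (x + 1 - 1) with x by ring.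
    rewrite div_pow_neg_even, div_pow_neg_odd.
    unfold smooth_part, smooth_part', diff_part; fold s.
    replace (1 - (1 - x)) with x by ring. field.
  - unfold f'.
    replace (odd_ext (smooth_part' q) (0 - x)) with (- smooth_part' q x).
    2:{ unfold odd_ext; destruct (Rlt_dec (0 - x) 0).
        - do 2 f_equal; ring.
        - replace (0 - x) with 0 by lra; replace x with 0 by lra.
          rewrite smooth_part'_0; ring. }
    unfold odd_ext; destruct (Rlt_dec (1 - x) 0); [lra|].
    replace (x + 0 - 1) with (- (1 - x)) by ring.
    replace (x + 1 - 1) with x by ring.
    rewrite div_pow_neg_odd.
    unfold smooth_part'; fold s.
    replace (1 - (1 - x)) with x by ring. field.
Qed.

(** The coefficient form of: the trace of the resolvent is - D'/D. *)
Lemma is_RInt_resolvent_num_diag (q : nat) :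
  is_RInt (fun x => resolvent_num q x x) 0 1 (- (INR (S q)) * char_coef (S q)).
Proof.
  set (F := fun x => diff_part q 0 * x - (-1) ^ q / 16 * div_pow (S (2 * q)) (2 * x - 1)).
  replace (- INR (S q) * char_coef (S q)) with (F 1 - F 0).
  - apply is_RInt_ext with (fun x => diff_part q 0 - (-1) ^ q / 8 * div_pow (2 * q) (2 * x - 1)).
    { intros x _; unfold resolvent_num.
      rewrite Rminus_diag, Rabs_R0; now replace (x + x - 1) with (2 * x - 1) by ring. }
    apply is_RInt_primitive.
    + intros x; unfold F; generalize (2 * q)%nat; intros n; auto_derive.
      { eexists; apply is_derive_div_pow. }
      rewrite (fun n x => is_derive_unique (fun x : R => div_pow (S n) x) x _ (is_derive_div_pow n x)).
      unfold Rminus; field.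
    + intros x; apply continuous_of_ex_derive; auto_derive; apply ex_derive_div_pow.
  - unfold F, diff_part.
    replace (2 * 0 - 1) with (- (1)) by ring.
    rewrite div_pow_neg_odd, div_pow_S_0, Rminus_0_r.
    replace (2 * 1 - 1) with 1 by ring.
    replace (- INR (S q) * char_coef (S q)) with (- INR (S q) * (4 * char_coef (S q)) / 4) by field.
    rewrite char_coef_S.
    replace (2 * S q)%nat with (S (S (2 * q))) by lia.
    replace (S (S (2 * q)) - 1)%nat with (S (2 * q)) by lia.
    unfold div_pow; rewrite !pow1, !INR_fact_S, !S_INR, !mult_INR; simpl (INR 2); simpl pow.
    pose proof (INR_fact_neq_0 (2 * q)); pose proof (pos_INR q).
    field; repeat split; lra || assumption.
Qed.

(** * Recursion for the traces of the iterated kernels *)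

(** The coefficient of X^(q+1) in the product of d_0 + d_1 X + ... and
    s_1 X + s_2 X^2 + ... *)
Definition newton_sum (d s : nat -> R) (q : nat) : R :=
  sum_n (fun k => d k * s (S q - k)%nat) q.

Lemma newton_sum_split (d s : nat -> R) (q : nat) :
  newton_sum d s q =
  d O * s (S q) + sum_n_m (fun k => d k * s (S q - k)%nat) 1 q.
Proof.
  unfold newton_sum, sum_n.
  rewrite sum_Sn_m by lia. reflexivity.
Qed.

(** The system is triangular with diagonal d_0. *)
Lemma newton_sum_inj (d s t : nat -> R) :
  d O <> 0 -> (forall q, newton_sum d s q = newton_sum d t q) ->
  forall p, (1 <= p)%nat -> s p = t p.
Proof.
  intros Hd H p; induction p as [p IH] using (well_founded_induction Wf_nat.lt_wf); intros Hp.
  destruct p as [|q]; [lia|].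
  specialize (H q); rewrite !newton_sum_split in H.
  rewrite (sum_n_m_ext_loc _ (fun k => d k * t (S q - k)%nat)) in H.
  - apply Rmult_eq_reg_l with (d O); auto; lra.
  - intros k Hk; rewrite IH; auto; lia.
Qed.

Lemma is_RInt_sum_n_m (f : nat -> R -> R) (v : nat -> R) (a b : R) (n m : nat) :
  (forall k, (n <= k <= m)%nat -> is_RInt (f k) a b (v k)) ->
  is_RInt (fun x => sum_n_m (fun k => f k x) n m) a b (sum_n_m v n m).
Proof.
  induction m as [|m IH]; intros H.
  - destruct n as [|n].
    + rewrite sum_n_n; apply is_RInt_ext with (f O); [|apply H; lia].
      intros; symmetry; apply (sum_n_n (fun k => f k x)).
    + rewrite sum_n_m_zero by lia.
      apply is_RInt_ext with (fun _ => 0).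
      { intros; symmetry; apply (sum_n_m_zero (fun k => f k x)); lia. }
      replace (zero : R) with (scal (b - a) 0) by apply Rmult_0_r.
      apply (is_RInt_const (V := R_NormedModule)).
  - destruct (le_lt_dec n (S m)) as [Hn|Hn].
    + rewrite sum_n_Sm by auto.
      apply is_RInt_ext with (fun x => plus (sum_n_m (fun k => f k x) n m) (f (S m) x)).
      { intros; symmetry; apply (sum_n_Sm (fun k => f k x)); auto. }
      apply (is_RInt_plus (V := R_NormedModule)).
      * apply IH; intros; apply H; lia.
      * apply H; lia.
    + rewrite sum_n_m_zero by lia.
      apply is_RInt_ext with (fun _ => 0).
      { intros; symmetry; apply (sum_n_m_zero (fun k => f k x)); lia. }
      replace (zero : R) with (scal (b - a) 0) by apply Rmult_0_r.
      apply (is_RInt_const (V := R_NormedModule)).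
Qed.

Lemma sum_n_m_Rmult_r (a : nat -> R) (c : R) (n m : nat) :
  sum_n_m (fun k => a k * c) n m = sum_n_m a n m * c.
Proof. exact (sum_n_m_mult_r (K := R_AbsRing) c a n m). Qed.

Lemma iter_kernel_SS (p : nat) (x y : R) : (1 <= p)%nat ->
  iter_kernel (S p) x y = RInt (fun z => iter_kernel p x z * K z y) 0 1.
Proof. destruct p; [lia|reflexivity]. Qed.

Lemma continuous_K_l (y z : R) : continuous (fun z => K z y) z.
Proof.
  unfold K.
  apply (continuous_ext (fun z => Rabs (z - y) * (- / 2))).
  { intros t; eqR; field. }
  apply continuous_Rmult; [apply continuous_Rabs_shift|apply continuous_const].
Qed.

(** The two claims feed each other: the expansion at q needs the integrals below
    q, and the integrand at q is integrable because the expansion writes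
    K_(q+1) as the continuous N_q minus lower iterated kernels. *)
Lemma iter_kernel_spec (q : nat) :
  (forall x y, I01 x -> I01 y ->
     resolvent_num q x y = newton_sum char_coef (fun p => iter_kernel p x y) q) /\
  (forall x y, I01 x -> I01 y ->
     is_RInt (fun z => iter_kernel (S q) x z * K z y) 0 1 (iter_kernel (S (S q)) x y)).
Proof.
  induction q as [q IH] using (well_founded_induction Wf_nat.lt_wf).
  assert (HN : forall x y, I01 x -> I01 y ->
     resolvent_num q x y = newton_sum char_coef (fun p => iter_kernel p x y) q).
  { intros x y Hx Hy.
    destruct q as [|q].
    - unfold newton_sum; rewrite sum_O, char_coef_0; simpl iter_kernel.
      rewrite resolvent_num_0 by auto; ring.
    - pose proof (resolvent_num_step q x y Hx Hy) as H1.
      assert (H2 : is_RInt (fun z => resolvent_num q x z * K z y) 0 1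
        (sum_n (fun k => char_coef k * iter_kernel (S (S q) - k) x y) q)).
      { apply is_RInt_ext with
          (fun z => sum_n_m (fun k => char_coef k * (iter_kernel (S q - k) x z * K z y)) 0 q).
        { intros z; rewrite Rmin_left, Rmax_right by lra; intros Hz.
          destruct (IH q ltac:(lia)) as [E _].
          rewrite E by (auto; unfold I01; lra).
          unfold newton_sum, sum_n; rewrite <- sum_n_m_Rmult_r.
          apply sum_n_m_ext; intros; eqR; ring. }
        apply is_RInt_sum_n_m; intros k Hk.
        apply (is_RInt_scal (V := R_NormedModule)).
        destruct (IH (q - k)%nat ltac:(lia)) as [_ E].
        replace (S q - k)%nat with (S (q - k)) by lia.
        replace (S (S q) - k)%nat with (S (S (q - k))) by lia.
        apply E; auto. }
      apply (is_RInt_unique (V := R_CompleteNormedModule)) in H1.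
      apply (is_RInt_unique (V := R_CompleteNormedModule)) in H2.
      rewrite H1 in H2.
      unfold newton_sum; rewrite sum_Sn; unfold plus; simpl AbelianMonoid.sort.
      match goal with |- _ = ?a => change (@eq R (resolvent_num (S q) x y) a) end.
      replace (S (S q) - S q)%nat with 1%nat by lia.
      cbn [iter_kernel].
      replace (resolvent_num (S q) x y) with
        (resolvent_num (S q) x y - char_coef (S q) * K x y + char_coef (S q) * K x y) by ring.
      rewrite H2; reflexivity. }
  split; auto.
  intros x y Hx Hy.
  rewrite (iter_kernel_SS (S q)) by lia.
  apply (RInt_correct (V := R_CompleteNormedModule)).
  apply ex_RInt_ext with (fun z => minus (resolvent_num q x z * K z y)
     (sum_n_m (fun k => char_coef k * (iter_kernel (S q - k) x z * K z y)) 1 q)).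
  { intros z; rewrite Rmin_left, Rmax_right by lra; intros Hz.
    rewrite HN by (auto; unfold I01; lra).
    rewrite newton_sum_split, char_coef_0.
    assert (E : sum_n_m (fun k => char_coef k * (iter_kernel (S q - k) x z * K z y)) 1 q
      = sum_n_m (fun k => char_coef k * iter_kernel (S q - k) x z) 1 q * K z y).
    { rewrite <- sum_n_m_Rmult_r; apply sum_n_m_ext; intros; eqR; ring. }
    rewrite E.
    unfold minus, plus, opp; simpl; ring. }
  apply (ex_RInt_minus (V := R_NormedModule)).
  - apply (ex_RInt_continuous (V := R_CompleteNormedModule)); intros z _.
    apply continuous_Rmult; [apply continuous_resolvent_num|apply continuous_K_l].
  - eexists; apply (is_RInt_sum_n_m (fun k z => char_coef k * (iter_kernel (S q - k) x z * K z y))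
      (fun k => char_coef k * iter_kernel (S (S q) - k) x y)).
    intros k Hk.
    apply (is_RInt_scal (V := R_NormedModule)).
    destruct (IH (q - k)%nat ltac:(lia)) as [_ E].
    replace (S q - k)%nat with (S (q - k)) by lia.
    replace (S (S q) - k)%nat with (S (S (q - k))) by lia.
    apply E; auto.
Qed.

Definition trace (p : nat) : R := RInt (fun x => iter_kernel p x x) 0 1.

Lemma is_RInt_trace (q : nat) : is_RInt (fun x => iter_kernel (S q) x x) 0 1 (trace (S q)).
Proof.
  induction q as [q IH] using (well_founded_induction Wf_nat.lt_wf).
  apply (RInt_correct (V := R_CompleteNormedModule)).
  apply ex_RInt_ext with (fun x => minus (resolvent_num q x x)
     (sum_n_m (fun k => char_coef k * iter_kernel (S q - k) x x) 1 q)).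
  { intros x; rewrite Rmin_left, Rmax_right by lra; intros Hx.
    rewrite (proj1 (iter_kernel_spec q)) by (unfold I01; lra).
    rewrite newton_sum_split, char_coef_0.
    unfold minus, plus, opp; simpl; ring. }
  apply (ex_RInt_minus (V := R_NormedModule)).
  - eexists; apply is_RInt_resolvent_num_diag.
  - eexists; apply (is_RInt_sum_n_m (fun k x => char_coef k * iter_kernel (S q - k) x x)
      (fun k => char_coef k * trace (S q - k))).
    intros k Hk; apply (is_RInt_scal (V := R_NormedModule)).
    replace (S q - k)%nat with (S (q - k)) by lia.
    apply IH; lia.
Qed.

(** Newton's identities for the traces, from the expansion on the diagonal. *)
Lemma newton_sum_trace (q : nat) :
  newton_sum char_coef trace q = - INR (S q) * char_coef (S q).
Proof.
  rewrite <- (is_RInt_unique (V := R_CompleteNormedModule) _ _ _ _ (is_RInt_resolvent_num_diag q)).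
  symmetry; apply (is_RInt_unique (V := R_CompleteNormedModule)).
  apply is_RInt_ext with
    (fun x => sum_n_m (fun k => char_coef k * iter_kernel (S q - k) x x) 0 q).
  { intros x; rewrite Rmin_left, Rmax_right by lra; intros Hx.
    symmetry; apply (proj1 (iter_kernel_spec q)); unfold I01; lra. }
  apply is_RInt_sum_n_m; intros k Hk; apply (is_RInt_scal (V := R_NormedModule)).
  replace (S q - k)%nat with (S (q - k)) by lia.
  apply is_RInt_trace.
Qed.

(** * Newton identities *)

Definition shift (c : nat -> R) (k : nat) : R := c (S k).
Definition unshift (c : nat -> R) (k : nat) : R :=
  match k with O => 0 | S j => c j end.

(** Horner form: recursion on the coefficient sequence makes division by a linear
    factor a structural recursion too. *)
Fixpoint peval (n : nat) (c : nat -> R) (x : R) : R :=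
  match n with O => 0 | S m => c O + x * peval m (shift c) x end.

Lemma peval_ext (n : nat) (c d : nat -> R) (x : R) :
  (forall k, (k < n)%nat -> c k = d k) -> peval n c x = peval n d x.
Proof.
  revert c d; induction n as [|n IH]; intros c d H; simpl; auto.
  rewrite (H O) by lia; rewrite (IH (shift c) (shift d)); auto.
  intros k Hk; apply H; lia.
Qed.

Lemma peval_linear (n : nat) (a b : R) (c d : nat -> R) (x : R) :
  peval n (fun k => a * c k + b * d k) x = a * peval n c x + b * peval n d x.
Proof.
  revert c d; induction n as [|n IH]; intros c d; simpl; [ring|].
  change (shift (fun k => a * c k + b * d k))
    with (fun k => a * shift c k + b * shift d k).
  rewrite IH; ring.
Qed.

Lemma peval_unshift (n : nat) (c : nat -> R) (x : R) :
  peval (S n) (unshift c) x = x * peval n c x.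
Proof. simpl; unfold shift; simpl; change (fun k => c k) with c; ring. Qed.

Lemma peval_trunc (n m : nat) (c : nat -> R) (x : R) :
  (n <= m)%nat -> (forall k, (n <= k < m)%nat -> c k = 0) ->
  peval m c x = peval n c x.
Proof.
  revert m c; induction n as [|n IH]; intros m c Hm H.
  - clear Hm; revert c H; induction m as [|m IHm]; intros c H; simpl; auto.
    rewrite (H O) by lia; rewrite IHm; [simpl; ring|].
    intros k Hk; apply H; lia.
  - destruct m as [|m]; [lia|]; simpl.
    rewrite (IH m); auto; [lia|]; intros k Hk; apply H; lia.
Qed.

(** Synthetic division: the coefficients of the quotient by x - r are the values
    at r of the successive tails. *)
Definition syndiv (n : nat) (c : nat -> R) (r : R) (j : nat) : R :=
  peval (n - j) (fun i => c (S j + i)%nat) r.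

Lemma peval_syndiv (n : nat) (c : nat -> R) (r x : R) :
  peval (S n) c x = peval (S n) c r + (x - r) * peval n (syndiv n c r) x.
Proof.
  revert c; induction n as [|n IH]; intros c; [simpl; ring|].
  change (peval (S (S n)) c x) with (c O + x * peval (S n) (shift c) x).
  change (peval (S (S n)) c r) with (c O + r * peval (S n) (shift c) r).
  change (peval (S n) (syndiv (S n) c r) x) with
    (peval (S n) (shift c) r + x * peval n (syndiv n (shift c) r) x).
  rewrite (IH (shift c)); ring.
Qed.

Lemma syndiv_rec (n : nat) (c : nat -> R) (r : R) (j : nat) : (j < n)%nat ->
  syndiv n c r j = c (S j) + r * syndiv n c r (S j).
Proof.
  intros Hj; unfold syndiv; replace (n - j)%nat with (S (n - S j)) by lia.
  simpl peval; f_equal; [f_equal; lia|].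
  f_equal; apply peval_ext; intros k _; unfold shift; f_equal; lia.
Qed.

(** Dividing out one root lowers the degree; when the quotient vanishes, the
    recurrence of synthetic division gives back that all coefficients vanish. *)
Lemma peval_unique (n : nat) (c : nat -> R) (l : list R) :
  NoDup l -> length l = n -> (forall x, In x l -> peval n c x = 0) ->
  forall k, (k < n)%nat -> c k = 0.
Proof.
  revert c l; induction n as [|n IH]; intros c l Hl Hn Hx k Hk; [lia|].
  destruct l as [|r l]; [discriminate|].
  inversion Hl as [|? ? Hr Hl']; subst.
  assert (Hb : forall j, (j < n)%nat -> syndiv n c r j = 0).
  { apply (IH _ l); auto.
    intros x Hxl.
    assert (x <> r) by (intros ->; auto).
    pose proof (Hx x (or_intror Hxl)) as E.
    rewrite (peval_syndiv n c r x), (Hx r (or_introl eq_refl)) in E.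
    apply Rmult_eq_reg_l with (x - r); lra. }
  destruct k as [|k].
  - specialize (Hx r (or_introl eq_refl)); simpl in Hx.
    destruct n as [|n]; [simpl in Hx; lra|].
    specialize (Hb O ltac:(lia)); unfold syndiv in Hb; simpl minus in Hb.
    change (peval (S n) (shift c) r = 0) in Hb; rewrite Hb in Hx; lra.
  - pose proof (syndiv_rec n c r k ltac:(lia)) as E; rewrite (Hb k ltac:(lia)) in E.
    destruct (Nat.eq_dec (S k) n) as [Ekn|Hkn].
    + rewrite Ekn in E; rewrite Ekn; unfold syndiv in E; rewrite Nat.sub_diag in E; simpl in E; lra.
    + rewrite (Hb (S k)) in E by lia; lra.
Qed.

(** Coefficients of the product of the 1 - a x over a in l: the entries of l are
    the inverses of the roots. *)
Fixpoint prod_coef (l : list R) : nat -> R :=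
  match l with
  | nil => fun k => match k with O => 1 | S _ => 0 end
  | a :: l => fun k => prod_coef l k - a * unshift (prod_coef l) k
  end.

Fixpoint power_sum (l : list R) (p : nat) : R :=
  match l with nil => 0 | a :: l => a ^ p + power_sum l p end.

Lemma prod_coef_0 (l : list R) : prod_coef l 0 = 1.
Proof. induction l; simpl; lra. Qed.

Lemma prod_coef_large (l : list R) (k : nat) : (length l < k)%nat -> prod_coef l k = 0.
Proof.
  revert k; induction l as [|a l IH]; intros k Hk; simpl in *; destruct k; try lia; auto.
  simpl; rewrite !IH by lia; ring.
Qed.

Lemma peval_prod_coef_root (l : list R) (a x : R) :
  In a l -> a * x = 1 -> peval (S (length l)) (prod_coef l) x = 0.
Proof.
  intros Hin Hax; induction l as [|b l IH]; [destruct Hin|].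
  assert (E : peval (S (length (b :: l))) (prod_coef (b :: l)) x
    = (1 - b * x) * peval (S (length l)) (prod_coef l) x).
  { simpl length.
    rewrite (peval_ext _ _ (fun k => 1 * prod_coef l k + (- b) * unshift (prod_coef l) k))
      by (intros; simpl; ring).
    rewrite peval_linear, peval_unshift.
    rewrite (peval_trunc (S (length l)) (S (S (length l)))); [ring|lia|].
    intros k Hk; apply prod_coef_large; lia. }
  rewrite E; destruct Hin as [<-|Hin]; [rewrite Hax; ring|].
  rewrite IH; auto; ring.
Qed.

Lemma sum_n_Rplus (u v : nat -> R) (n : nat) :
  sum_n (fun k => u k + v k) n = sum_n u n + sum_n v n.
Proof. exact (sum_n_plus u v n). Qed.

Lemma sum_n_Rmult_l (c : R) (u : nat -> R) (n : nat) :
  sum_n (fun k => c * u k) n = c * sum_n u n.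
Proof. exact (sum_n_mult_l (K := R_AbsRing) c u n). Qed.

(** Induction on the factors: a new factor 1 - a x adds a^p to s_p. The terms with
    the old power sums are the hypothesis at q and at q - 1, and those with powers
    of a telescope. *)
Lemma newton_identities (l : list R) (q : nat) :
  newton_sum (prod_coef l) (power_sum l) q = - INR (S q) * prod_coef l (S q).
Proof.
  revert q; induction l as [|a l IH]; intros q.
  - unfold newton_sum; simpl power_sum.
    rewrite (sum_n_ext _ (fun _ => 0)) by (intros; eqR; ring).
    rewrite sum_n_const; simpl prod_coef; ring.
  - set (d := prod_coef l); set (s := power_sum l) in *.
    (* the powers of the new inverse root telescope *)
    assert (G : forall n, (n <= q)%nat ->
      sum_n (fun k => (d k - a * unshift d k) * a ^ (S q - k)) n = d n * a ^ (S q - n)).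
    { induction n as [|n IHn]; intros Hn.
      - rewrite sum_O; simpl unshift; eqR; ring.
      - rewrite sum_Sn, IHn by lia; unfold plus; simpl AbelianMonoid.sort.
        replace (S q - n)%nat with (S (S q - S n)) by lia; simpl; eqR; ring. }
    (* the shifted sum is the identity for q - 1 *)
    assert (U : sum_n (fun k => unshift d k * s (S q - k)%nat) q = - INR q * d q).
    { destruct q as [|q]; [rewrite sum_O; simpl; eqR; ring|].
      unfold sum_n; rewrite sum_Sn_m by lia; unfold plus; simpl AbelianMonoid.sort.
      rewrite <- sum_n_m_S; simpl unshift.
      specialize (IH q); fold d in IH; unfold newton_sum, sum_n in IH.
      rewrite <- IH; simpl; eqR; ring. }
    unfold newton_sum.
    rewrite (sum_n_ext _ (fun k => d k * s (S q - k)%nat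
       + (- a) * (unshift d k * s (S q - k)%nat)
       + (d k - a * unshift d k) * a ^ (S q - k)))
      by (intros k; simpl; fold d s; eqR; ring).
    rewrite sum_n_Rplus, sum_n_Rplus, sum_n_Rmult_l, U, (G q) by lia.
    specialize (IH q); fold d s in IH; unfold newton_sum in IH; rewrite IH.
    replace (S q - q)%nat with 1%nat by lia.
    cbn [prod_coef unshift]; fold d.
    simpl; change (match q with O => 1 | S _ => INR q + 1 end) with (INR (S q)).
    rewrite S_INR; eqR; ring.
Qed.

(** * Discretised characteristic polynomial *)

(** The product (x^2 - 0^2) (x^2 - 1^2) ... (x^2 - (k-1)^2), the numerator of the
    coefficients of Chebyshev polynomials expanded at 1. *)
Fixpoint square_fall (x : R) (k : nat) : R :=
  match k with O => 1 | S j => square_fall x j * (x ^ 2 - INR j ^ 2) end.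

(** Sum and difference at x+1 and x-1 form a closed system in k, which is why both
    are proved together. The sum yields the Chebyshev recurrence, the difference
    the coefficients of T_(M-1) - T_(M+1). *)
Lemma square_fall_neighbours (x : R) (k : nat) :
  square_fall (x + 1) (S k) + square_fall (x - 1) (S k) =
    square_fall x k * (2 * (x ^ 2 - INR k ^ 2) + (2 * INR k + 2) * (2 * INR k + 1)) /\
  x * (square_fall (x + 1) (S k) - square_fall (x - 1) (S k)) =
    square_fall x k * (4 * (INR k + 1) * x ^ 2 + 2 * INR k * (INR k + 1)).
Proof.
  induction k as [|k [IH1 IH2]]; [simpl; split; ring|].
  set (p := square_fall (x + 1) (S k)) in *; set (m := square_fall (x - 1) (S k)) in *.
  change (square_fall (x + 1) (S (S k))) with (p * ((x + 1) ^ 2 - INR (S k) ^ 2)).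
  change (square_fall (x - 1) (S (S k))) with (m * ((x - 1) ^ 2 - INR (S k) ^ 2)).
  change (square_fall x (S k)) with (square_fall x k * (x ^ 2 - INR k ^ 2)).
  rewrite S_INR; set (j := INR k) in *; set (f := square_fall x k) in *.
  split.
  - replace (p * ((x + 1) ^ 2 - (j + 1) ^ 2) + m * ((x - 1) ^ 2 - (j + 1) ^ 2))
      with ((x ^ 2 + 1 - (j + 1) ^ 2) * (p + m) + 2 * (x * (p - m))) by ring.
    rewrite IH1, IH2; ring.
  - replace (x * (p * ((x + 1) ^ 2 - (j + 1) ^ 2) - m * ((x - 1) ^ 2 - (j + 1) ^ 2)))
      with ((x ^ 2 + 1 - (j + 1) ^ 2) * (x * (p - m)) + 2 * x ^ 2 * (p + m)) by ring.
    rewrite IH1, IH2; ring.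
Qed.

Lemma square_fall_large (n k : nat) : (n < k)%nat -> square_fall (INR n) k = 0.
Proof.
  induction k as [|k IH]; intros Hk; [lia|]; simpl square_fall.
  destruct (Nat.eq_dec n k) as [->|]; [ring|].
  rewrite IH by lia; ring.
Qed.

(** Coefficients of the Chebyshev polynomial T_x(cos t) in powers of
    2 - 2 cos t. The degree is a real number so that neighbouring degrees are
    x + 1 and x - 1. *)
Definition cheb_coef (x : R) (k : nat) : R :=
  (-1) ^ k * square_fall x k / INR (fact (2 * k)).

Lemma cheb_coef_rec (x : R) (k : nat) :
  cheb_coef (x + 1) k = 2 * cheb_coef x k - cheb_coef (x - 1) k - unshift (cheb_coef x) k.
Proof.
  destruct k as [|k]; [unfold cheb_coef; simpl; field|].
  destruct (square_fall_neighbours x k) as [H _].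
  unfold unshift, cheb_coef.
  replace (square_fall (x + 1) (S k)) with
    (square_fall x k * (2 * (x ^ 2 - INR k ^ 2) + (2 * INR k + 2) * (2 * INR k + 1))
      - square_fall (x - 1) (S k)) by lra.
  change (square_fall x (S k)) with (square_fall x k * (x ^ 2 - INR k ^ 2)).
  replace (2 * S k)%nat with (S (S (2 * k))) by lia.
  rewrite !INR_fact_S, !S_INR, !mult_INR; simpl (INR 2); simpl ((-1) ^ S k).
  pose proof (INR_fact_neq_0 (2 * k)); pose proof (pos_INR k).
  field; repeat split; lra || assumption.
Qed.

(** Stated for any sequence with the Chebyshev recurrence, so that it applies both
    to cos(n t) and to cosh(n t). *)
Lemma cheb_peval (a : nat -> R) (c : R) (n : nat) :
  a O = 1 -> a 1%nat = c ->
  (forall n, a (S (S n)) = 2 * c * a (S n) - a n) ->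
  forall m, (n < m)%nat -> a n = peval m (cheb_coef (INR n)) (2 - 2 * c).
Proof.
  intros H0 H1 Hr.
  assert (B0 : forall m, (0 < m)%nat -> a O = peval m (cheb_coef (INR 0)) (2 - 2 * c)).
  { intros m Hm.
    rewrite (peval_trunc 1 m); [|lia|].
    - unfold cheb_coef; simpl; rewrite H0; field.
    - intros k Hk; unfold cheb_coef; rewrite square_fall_large by lia; unfold Rdiv; ring. }
  assert (B1 : forall m, (1 < m)%nat -> a 1%nat = peval m (cheb_coef (INR 1)) (2 - 2 * c)).
  { intros m Hm.
    rewrite (peval_trunc 2 m); [|lia|].
    - unfold cheb_coef; simpl peval; unfold shift; simpl; rewrite H1; field.
    - intros k Hk; unfold cheb_coef; rewrite square_fall_large by lia; unfold Rdiv; ring. }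
  enough (G : (forall m, (n < m)%nat -> a n = peval m (cheb_coef (INR n)) (2 - 2 * c)) /\
    (forall m, (S n < m)%nat -> a (S n) = peval m (cheb_coef (INR (S n))) (2 - 2 * c)))
    by apply G.
  induction n as [|n [IH1 IH2]]; [split; auto|].
  split; auto.
  intros m Hm; rewrite Hr, (IH1 m), (IH2 m) by lia.
  set (x := INR (S n)).
  replace (INR (S (S n))) with (x + 1) by (unfold x; rewrite (S_INR (S n)); ring).
  replace (INR n) with (x - 1) by (unfold x; rewrite (S_INR n); ring).
  rewrite (peval_ext m (cheb_coef (x + 1))
    (fun k => 1 * (2 * cheb_coef x k + (-1) * cheb_coef (x - 1) k)
              + (-1) * unshift (cheb_coef x) k)).
  2:{ intros k _; rewrite cheb_coef_rec; ring. }
  rewrite !peval_linear.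
  replace (peval m (unshift (cheb_coef x)) (2 - 2 * c))
    with ((2 - 2 * c) * peval m (cheb_coef x) (2 - 2 * c)); [ring|].
  rewrite <- peval_unshift.
  apply peval_trunc; [lia|].
  intros k Hk; replace k with (S (S n + 1 + (k - n - 3))) by lia; simpl unshift.
  unfold cheb_coef, x; rewrite square_fall_large by lia; unfold Rdiv; ring.
Qed.

(** Coefficients of (1 + T_M)/2 + (M/8) (T_(M-1) - T_(M+1)) in powers of
    M^2 (2 - 2 cos t), which discretises D: the first part tends to
    (1 + cos w)/2 and, as T_(M-1) - T_(M+1) is 2 sin t sin(M t), the second one
    to (w sin w)/4. *)
Definition disc_coef (x : R) (k : nat) : R :=
  ((if Nat.eqb k 0 then / 2 else 0) + / 2 * cheb_coef x k
   + x / 8 * (cheb_coef (x - 1) k - cheb_coef (x + 1) k)) * (/ x ^ 2) ^ k.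

Lemma peval_scale (n : nat) (c : nat -> R) (s x : R) :
  peval n (fun k => c k * s ^ k) x = peval n c (s * x).
Proof.
  enough (G : forall t, peval n (fun k => c k * (t * s ^ k)) x = t * peval n c (s * x)).
  { rewrite <- (Rmult_1_l (peval n c (s * x))), <- G.
    apply peval_ext; intros; ring. }
  revert c; induction n as [|n IH]; intros c t; simpl; [ring|].
  rewrite (peval_ext n (shift (fun k => c k * (t * s ^ k)))
    (fun k => shift c k * (t * s * s ^ k))) by (intros; unfold shift; simpl; ring).
  rewrite IH; ring.
Qed.

Lemma peval_disc_coef (a : nat -> R) (c y : R) (m : nat) : (1 <= m)%nat ->
  a O = 1 -> a 1%nat = c ->
  (forall n, a (S (S n)) = 2 * c * a (S n) - a n) ->
  y = INR m ^ 2 * (2 - 2 * c) ->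
  peval (m + 2) (disc_coef (INR m)) y =
  / 2 + / 2 * a m + INR m / 8 * (a (m - 1)%nat - a (m + 1)%nat).
Proof.
  intros Hm H0 H1 Hr Hy.
  unfold disc_coef; rewrite peval_scale.
  assert (Hmp : 0 < INR m) by (apply lt_0_INR; lia).
  replace (/ INR m ^ 2 * y) with (2 - 2 * c) by (rewrite Hy; field; lra).
  rewrite (peval_ext _ _ (fun k =>
    1 * (1 * (if Nat.eqb k 0 then / 2 else 0) + / 2 * cheb_coef (INR m) k) +
    INR m / 8 * (1 * cheb_coef (INR m - 1) k + (-1) * cheb_coef (INR m + 1) k)))
    by (intros; ring).
  rewrite !peval_linear.
  rewrite (peval_trunc 1 (m + 2)); [|lia|intros k Hk; destruct k; [lia|reflexivity]].
  replace (INR m - 1) with (INR (m - 1)) by (rewrite minus_INR by lia; reflexivity).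
  replace (INR m + 1) with (INR (m + 1)) by (rewrite plus_INR; reflexivity).
  rewrite <- !(fun n => cheb_peval a c n H0 H1 Hr) by lia.
  simpl peval; ring.
Qed.

(** Regrouped so that every factor has a visible limit as x grows. *)
Lemma disc_coef_S (x : R) (k : nat) : x <> 0 ->
  disc_coef x (S k) =
  (-1) ^ S k / INR (fact (2 * S k)) * (square_fall x k * (/ x ^ 2) ^ k) *
  (/ 2 * (1 - INR k ^ 2 * / x ^ 2)
   - / 8 * (4 * (INR k + 1) + 2 * INR k * (INR k + 1) * / x ^ 2)).
Proof.
  intros Hx; unfold disc_coef, cheb_coef; simpl Nat.eqb; cbv iota.
  destruct (square_fall_neighbours x k) as [_ H].
  set (s := (-1) ^ S k / INR (fact (2 * S k))).
  transitivity (s * (/ 2 * square_fall x (S k)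
    - / 8 * (x * (square_fall (x + 1) (S k) - square_fall (x - 1) (S k)))) * (/ x ^ 2) ^ S k).
  { unfold s; field; auto using INR_fact_neq_0. }
  rewrite H; change (square_fall x (S k)) with (square_fall x k * (x ^ 2 - INR k ^ 2)).
  rewrite <- (tech_pow_Rmult (/ x ^ 2) k); generalize ((/ x ^ 2) ^ k); intros t.
  field; auto.
Qed.

Lemma is_lim_seq_square_fall (x : nat -> R) (k : nat) :
  (forall n, x n <> 0) -> is_lim_seq (fun n => / x n ^ 2) 0 ->
  is_lim_seq (fun n => square_fall (x n) k * (/ x n ^ 2) ^ k) 1.
Proof.
  intros Hx Hl; induction k as [|k IH].
  - apply is_lim_seq_ext with (fun _ => 1); [intros; simpl; ring|apply is_lim_seq_const].
  - apply is_lim_seq_ext with (fun n =>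
      square_fall (x n) k * (/ x n ^ 2) ^ k * (1 - INR k ^ 2 * / x n ^ 2)).
    { intros n; rewrite <- (tech_pow_Rmult (/ x n ^ 2) k); simpl square_fall; generalize ((/ x n ^ 2) ^ k); intros t; field; auto. }
    replace (Finite 1) with (Finite (1 * (1 - INR k ^ 2 * 0))) by (f_equal; ring).
    apply is_lim_seq_mult'; auto.
    apply is_lim_seq_minus'; [apply is_lim_seq_const|].
    apply is_lim_seq_mult'; [apply is_lim_seq_const|auto].
Qed.

Lemma is_lim_seq_disc_coef (x : nat -> R) (k : nat) :
  (forall n, x n <> 0) -> is_lim_seq (fun n => / x n ^ 2) 0 ->
  is_lim_seq (fun n => disc_coef (x n) k) (char_coef k).
Proof.
  intros Hx Hl; destruct k as [|k].
  - apply is_lim_seq_ext with (fun _ => 1).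
    { intros n; unfold disc_coef, cheb_coef; simpl; field. }
    rewrite char_coef_0; apply is_lim_seq_const.
  - eapply is_lim_seq_ext; [intros n; symmetry; apply disc_coef_S; auto|].
    replace (char_coef (S k)) with
      ((-1) ^ S k / INR (fact (2 * S k)) * 1 *
       (/ 2 * (1 - INR k ^ 2 * 0) - / 8 * (4 * (INR k + 1) + 2 * INR k * (INR k + 1) * 0))).
    2:{ unfold char_coef; simpl Nat.eqb; cbv iota; rewrite S_INR; field; apply INR_fact_neq_0. }
    apply is_lim_seq_mult'.
    + apply is_lim_seq_mult'; [apply is_lim_seq_const|].
      apply is_lim_seq_square_fall; auto.
    + apply is_lim_seq_minus'; (apply is_lim_seq_mult'; [apply is_lim_seq_const|]).
      * apply is_lim_seq_minus'; [apply is_lim_seq_const|].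
        apply is_lim_seq_mult'; [apply is_lim_seq_const|auto].
      * apply is_lim_seq_plus'; [apply is_lim_seq_const|].
        apply is_lim_seq_mult'; [apply is_lim_seq_const|auto].
Qed.

(** * Roots of the characteristic equations *)

Lemma cos_sin_half_turns (k : nat) (w : R) :
  cos (INR k * PI - w) = (-1) ^ k * cos w /\
  sin (INR k * PI - w) = - (-1) ^ k * sin w.
Proof.
  induction k as [|k [IH1 IH2]].
  - simpl; rewrite Rmult_0_l, Rminus_0_l, cos_neg, sin_neg; split; ring.
  - replace (INR (S k) * PI - w) with (INR k * PI - w + PI) by (rewrite S_INR; ring).
    rewrite neg_cos, neg_sin, IH1, IH2; simpl; split; ring.
Qed.

(** The root of cos z + r(z) sin z in the quarter turn that ends at k pi, written
    z = k pi - w to make the sign of the function at both ends independent of the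
    parity of k. The response r is the identity for the differential equation and
    N sin(z/N) for its discretisation. *)
Lemma phase_exists (r : R -> R) (k : nat) :
  continuity r -> 0 < r (INR k * PI - PI / 2) ->
  {w | 0 < w < PI / 2 /\ r (INR k * PI - w) * sin w = cos w}.
Proof.
  intros Hc Hr.
  pose proof PI_RGT_0 as HPI.
  destruct (IVT (fun w => r (INR k * PI - w) * sin w - cos w) 0 (PI / 2)) as [w [Hw E]].
  - intros w; apply continuity_pt_minus; [apply continuity_pt_mult|].
    + apply (continuity_pt_comp (fun w => INR k * PI - w) r); [|apply Hc].
      apply continuity_pt_filterlim, continuous_of_ex_derive; auto_derive; auto.
    + apply continuity_sin.
    + apply continuity_cos.
  - lra.
  - rewrite sin_0, cos_0; lra.
  - rewrite sin_PI2, cos_PI2; lra.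
  - exists w; split; [|lra].
    assert (w <> 0) by (intros ->; rewrite sin_0, cos_0 in E; lra).
    assert (w <> PI / 2) by (intros ->; rewrite sin_PI2, cos_PI2 in E; lra).
    lra.
Qed.

(** The function changes sign on (0,2] because cosh 2 < 2 sinh 2. The root gives
    the negative eigenvalue. *)
Lemma hyp_root_exists (r : R -> R) : continuity r -> 2 <= r 2 ->
  {x | 0 < x <= 2 /\ r x * sinh x = cosh x}.
Proof.
  intros Hc Hr.
  destruct (IVT (fun x => r x * sinh x - cosh x) 0 2) as [x [Hx E]].
  - intros x; apply continuity_pt_minus; [apply continuity_pt_mult; [apply Hc|]|].
    + apply derivable_continuous, derivable_sinh.
    + apply derivable_continuous, derivable_cosh.
  - lra.
  - rewrite sinh_0, cosh_0; lra.
  - pose proof (exp_ineq1 2 ltac:(lra)) as H1.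
    assert (exp (Ropp 2) < 1) by (rewrite <- exp_0; apply exp_increasing; lra).
    assert (cosh 2 < 2 * sinh 2) by (unfold cosh, sinh; lra).
    assert (0 < sinh 2) by (unfold sinh; lra).
    nra.
  - exists x; split; [|lra].
    assert (x <> 0) by (intros ->; rewrite sinh_0, cosh_0 in E; lra).
    lra.
Qed.

(** When w lists the roots of [phase_exists], the nodes are the positive roots of
    cos z (cos z + r(z) sin z) in increasing order, odd i belonging to the first
    factor and even i to the second. *)
Definition node (w : nat -> R) (i : nat) : R :=
  INR i * PI / 2 - (if Nat.even i then w (Nat.div2 i) else 0).

Lemma even_double (i : nat) : Nat.even i = true -> i = (2 * Nat.div2 i)%nat.
Proof.
  intros H; apply Nat.even_spec in H; destruct H as [k ->].
  now rewrite Nat.div2_double.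
Qed.

Lemma node_bounds (w : nat -> R) (i : nat) : (1 <= i)%nat ->
  (Nat.even i = true -> 0 < w (Nat.div2 i) < PI / 2) ->
  INR (i - 1) * PI / 2 < node w i <= INR i * PI / 2.
Proof.
  intros Hi Hw; unfold node; pose proof PI_RGT_0.
  rewrite minus_INR by auto; simpl (INR 1).
  destruct (Nat.even i); [specialize (Hw eq_refl)|]; lra.
Qed.

Lemma node_equation (r : R -> R) (w : nat -> R) (i : nat) :
  (Nat.even i = true ->
     let k := Nat.div2 i in r (INR k * PI - w k) * sin (w k) = cos (w k)) ->
  cos (node w i) * (cos (node w i) + r (node w i) * sin (node w i)) = 0.
Proof.
  intros Hw; unfold node; destruct (Nat.even i) eqn:E.
  - specialize (Hw eq_refl); simpl in Hw.
    apply even_double in E.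
    replace (INR i * PI / 2) with (INR (Nat.div2 i) * PI).
    2:{ rewrite E at 2; rewrite mult_INR; simpl; field. }
    destruct (cos_sin_half_turns (Nat.div2 i) (w (Nat.div2 i))) as [C S].
    rewrite C, S, <- Hw; ring.
  - assert (O : Nat.odd i = true) by (unfold Nat.odd; rewrite E; reflexivity).
    apply Nat.odd_spec in O; destruct O as [k ->].
    replace (INR (2 * k + 1) * PI / 2 - 0) with (INR k * PI - (- (PI / 2))).
    2:{ rewrite plus_INR, mult_INR; simpl; field. }
    destruct (cos_sin_half_turns k (- (PI / 2))) as [C _].
    rewrite C, cos_neg, cos_PI2; ring.
Qed.

Lemma node_lower (w : nat -> R) (i : nat) : (1 <= i)%nat ->
  (Nat.even i = true -> 0 < w (Nat.div2 i) < PI / 2) -> INR i / 2 <= node w i.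
Proof.
  intros Hi Hw; pose proof (node_bounds w i Hi Hw) as [H _].
  pose proof PI2_1 as HP.
  destruct (Nat.eq_dec i 1) as [->|Hi1].
  - unfold node; simpl; lra.
  - rewrite minus_INR in H by auto.
    assert (H2 : INR 2 <= INR i) by (apply le_INR; lia).
    simpl in H, H2; nra.
Qed.

(** The i-th node lies in a half-open quarter turn that depends on i only. *)
Lemma node_separated (w v : nat -> R) (i j : nat) : (1 <= i)%nat -> (1 <= j)%nat ->
  (Nat.even i = true -> 0 < w (Nat.div2 i) < PI / 2) ->
  (Nat.even j = true -> 0 < v (Nat.div2 j) < PI / 2) ->
  node w i = node v j -> i = j.
Proof.
  intros Hi Hj Hw Hv E.
  pose proof (node_bounds w i Hi Hw); pose proof (node_bounds v j Hj Hv).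
  pose proof PI_RGT_0.
  destruct (lt_eq_lt_dec i j) as [[L|L]|L]; auto; exfalso.
  - assert (INR i <= INR (j - 1)) by (apply le_INR; lia); nra.
  - assert (INR j <= INR (i - 1)) by (apply le_INR; lia); nra.
Qed.

(** With f = sin or sinh, the finite-difference counterpart of z. *)
Definition dilate (f : R -> R) (n : nat) (z : R) : R :=
  INR (S n) * f (z / INR (S n)).

Lemma dilate_sin_pos (n : nat) (z : R) : 0 < z < INR (S n) * PI -> 0 < dilate sin n z.
Proof.
  intros [H1 H2]; pose proof (lt_0_INR (S n) ltac:(lia)) as Hn.
  apply Rmult_lt_0_compat; auto; apply sin_gt_0.
  - apply Rdiv_lt_0_compat; auto.
  - apply Rmult_lt_reg_l with (INR (S n)); auto; field_simplify; lra.
Qed.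

Lemma dilate_continuity (f : R -> R) (n : nat) : continuity f -> continuity (dilate f n).
Proof.
  intros Hf z; apply continuity_pt_mult; [apply continuity_pt_const; intros ? ?; auto|].
  apply (continuity_pt_comp (fun z => z / INR (S n)) f); [|apply Hf].
  apply continuity_pt_mult; [apply derivable_continuous, derivable_id|].
  apply continuity_pt_const; intros ? ?; auto.
Qed.

(** The range is asserted for all k, including those for which there is no root,
    so that sequences in n are bounded from the start. *)
Lemma disc_phase_exists (n k : nat) : {w | 0 <= w <= PI / 2 /\ ((1 <= k <= S n)%nat ->
  0 < w < PI / 2 /\ dilate sin n (INR k * PI - w) * sin w = cos w)}.
Proof.
  pose proof PI_RGT_0 as HPI.
  destruct (le_dec 1 k) as [H1|]; [|exists 0; split; [lra|lia]].
  destruct (le_dec k (S n)) as [H2|]; [|exists 0; split; [lra|lia]].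
  destruct (phase_exists (dilate sin n) k) as [w Hw]; [| |exists w; split; [lra|auto]].
  - apply dilate_continuity, continuity_sin.
  - apply dilate_sin_pos; pose proof PI_RGT_0.
    apply le_INR in H1; apply le_INR in H2; simpl (INR 1) in H1; nra.
Qed.

Lemma limit_phase_exists (k : nat) : {w | (1 <= k)%nat ->
  0 < w < PI / 2 /\ (INR k * PI - w) * sin w = cos w}.
Proof.
  destruct (le_dec 1 k) as [H1|]; [|exists 0; lia].
  destruct (phase_exists (fun z => z) k) as [w Hw]; [| |exists w; auto].
  - apply derivable_continuous, derivable_id.
  - pose proof PI_RGT_0; apply le_INR in H1; simpl (INR 1) in H1; nra.
Qed.

Lemma sinh_ge_id (x : R) : 0 <= x -> x <= sinh x.
Proof.
  intros [Hx|<-]; [|rewrite sinh_0; lra].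
  destruct (MVT_cor2 sinh cosh 0 x Hx) as [c [E Hc]].
  { intros; apply derivable_pt_lim_sinh. }
  rewrite sinh_0 in E.
  assert (1 <= cosh c); [|nra].
  unfold cosh; pose proof (exp_pos c).
  assert (exp c * exp (- c) = 1) by (rewrite <- exp_plus, Rplus_opp_r; apply exp_0).
  assert (0 <= exp (- c) * (exp c - 1) ^ 2).
  { apply Rmult_le_pos; [apply Rlt_le, exp_pos|apply pow2_ge_0]. }
  nra.
Qed.

Lemma disc_hyp_root_exists (n : nat) :
  {x | 0 < x <= 2 /\ dilate sinh n x * sinh x = cosh x}.
Proof.
  apply hyp_root_exists.
  - apply dilate_continuity, derivable_continuous, derivable_sinh.
  - pose proof (lt_0_INR (S n) ltac:(lia)) as Hn.
    unfold dilate.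
    assert (2 / INR (S n) <= sinh (2 / INR (S n))).
    { apply sinh_ge_id, Rlt_le, Rdiv_lt_0_compat; lra. }
    replace 2 with (INR (S n) * (2 / INR (S n))) at 1 by (field; lra).
    apply Rmult_le_compat_l; lra.
Qed.

Lemma limit_hyp_root_exists : {x | 0 < x <= 2 /\ x * sinh x = cosh x}.
Proof.
  apply (hyp_root_exists (fun x => x)); [apply derivable_continuous, derivable_id|lra].
Qed.

Definition disc_phase (n k : nat) : R := proj1_sig (disc_phase_exists n k).
Definition limit_phase (k : nat) : R := proj1_sig (limit_phase_exists k).
Definition disc_hyp_root (n : nat) : R := proj1_sig (disc_hyp_root_exists n).
Definition limit_hyp_root : R := proj1_sig limit_hyp_root_exists.

Lemma disc_phase_spec (n k : nat) : (1 <= k <= S n)%nat ->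
  0 < disc_phase n k < PI / 2 /\
  dilate sin n (INR k * PI - disc_phase n k) * sin (disc_phase n k) = cos (disc_phase n k).
Proof. exact (proj2 (proj2_sig (disc_phase_exists n k))). Qed.
Lemma disc_phase_range (n k : nat) : 0 <= disc_phase n k <= PI / 2.
Proof. exact (proj1 (proj2_sig (disc_phase_exists n k))). Qed.
Lemma limit_phase_spec (k : nat) : (1 <= k)%nat ->
  0 < limit_phase k < PI / 2 /\
  (INR k * PI - limit_phase k) * sin (limit_phase k) = cos (limit_phase k).
Proof. exact (proj2_sig (limit_phase_exists k)). Qed.
Lemma disc_hyp_root_spec (n : nat) : 0 < disc_hyp_root n <= 2 /\
  dilate sinh n (disc_hyp_root n) * sinh (disc_hyp_root n) = cosh (disc_hyp_root n).
Proof. exact (proj2_sig (disc_hyp_root_exists n)). Qed.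
Lemma limit_hyp_root_spec : 0 < limit_hyp_root <= 2 /\
  limit_hyp_root * sinh limit_hyp_root = cosh limit_hyp_root.
Proof. exact (proj2_sig limit_hyp_root_exists). Qed.

(** The roots 2 M^2 (1 - cos t) = 4 M^2 sin^2(t/2) with M = 2 (n+1) and t the
    i-th node divided by n + 1; index 0 is the hyperbolic root. *)
Definition disc_eigenvalue (n i : nat) : R :=
  match i with
  | O => - (4 * dilate sinh n (disc_hyp_root n / 2)) ^ 2
  | S _ => (4 * dilate sin n (node (disc_phase n) i / 2)) ^ 2
  end.

(** The eigenvalues in increasing order, since the nodes increase. *)
Definition eigenvalue_list (i : nat) : R :=
  match i with
  | O => - (2 * limit_hyp_root) ^ 2
  | S _ => (2 * node limit_phase i) ^ 2
  end.

Lemma disc_node_phase (n i : nat) : (1 <= i <= 2 * S n)%nat ->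
  (Nat.even i = true -> (1 <= Nat.div2 i <= S n)%nat).
Proof. intros Hi H; apply even_double in H; lia. Qed.

Lemma disc_node_bounds (n i : nat) : (1 <= i <= 2 * S n)%nat ->
  0 < node (disc_phase n) i <= INR (S n) * PI.
Proof.
  intros Hi.
  destruct (node_bounds (disc_phase n) i) as [H1 H2]; [lia| |].
  { intros E; apply disc_phase_spec, disc_node_phase; auto. }
  pose proof PI_RGT_0; pose proof (pos_INR (i - 1)).
  assert (INR i <= INR (2 * S n)) by (apply le_INR; lia).
  rewrite mult_INR in *; simpl (INR 2) in *; nra.
Qed.

Lemma disc_node_arg (n i : nat) : (1 <= i <= 2 * S n)%nat ->
  0 < node (disc_phase n) i / 2 / INR (S n) <= PI / 2.
Proof.
  intros Hi; destruct (disc_node_bounds n i Hi) as [H1 H2].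
  pose proof (lt_0_INR (S n) ltac:(lia)) as Hn.
  split; [apply Rdiv_lt_0_compat; lra|].
  apply Rmult_le_reg_l with (INR (S n)); auto.
  replace (INR (S n) * (node (disc_phase n) i / 2 / INR (S n)))
    with (node (disc_phase n) i / 2) by (field; lra).
  lra.
Qed.

Lemma sin_ge_third (t : R) : 0 <= t <= PI / 2 -> t / 3 <= sin t.
Proof.
  intros Ht; pose proof PI_4.
  destruct (sin_bound t 0) as [H1 _]; try lra.
  replace (sin_approx t (2 * 0 + 1)) with (t - t ^ 3 / 6) in H1
    by (unfold sin_approx, sin_term; simpl; field).
  assert (t ^ 2 <= 4) by nra.
  nra.
Qed.

(** Uniformity in n makes this the dominating bound for the limit of the power
    sums. *)
Lemma disc_eigenvalue_lower (n i : nat) : (1 <= i <= 2 * S n)%nat ->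
  (INR i / 3) ^ 2 <= disc_eigenvalue n i.
Proof.
  intros Hi; destruct i as [|i]; [lia|]; unfold disc_eigenvalue.
  pose proof (disc_node_arg n (S i) Hi) as Ha.
  pose proof (lt_0_INR (S n) ltac:(lia)) as Hn.
  assert (INR (S i) / 2 <= node (disc_phase n) (S i)).
  { apply node_lower; [lia|]; intros E; apply disc_phase_spec, disc_node_phase; auto. }
  apply pow_incr; split; [pose proof (pos_INR (S i)); lra|].
  apply Rle_trans with
    (4 * (INR (S n) * (node (disc_phase n) (S i) / 2 / INR (S n) / 3))).
  { replace (INR (S n) * (node (disc_phase n) (S i) / 2 / INR (S n) / 3))
      with (node (disc_phase n) (S i) / 6) by (field; lra).
    lra. }
  apply Rmult_le_compat_l; [lra|]; apply Rmult_le_compat_l; [lra|].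
  apply sin_ge_third; lra.
Qed.

Lemma disc_eigenvalue_pos (n i : nat) : (1 <= i <= 2 * S n)%nat -> 0 < disc_eigenvalue n i.
Proof.
  intros Hi; eapply Rlt_le_trans; [|apply disc_eigenvalue_lower; auto].
  apply pow_lt; pose proof (lt_0_INR i ltac:(lia)); lra.
Qed.

Lemma disc_eigenvalue_neg (n : nat) : disc_eigenvalue n 0 < 0.
Proof.
  unfold disc_eigenvalue, dilate; destruct (disc_hyp_root_spec n) as [H _].
  pose proof (lt_0_INR (S n) ltac:(lia)) as Hn.
  assert (Ht : 0 < disc_hyp_root n / 2 / INR (S n)) by (apply Rdiv_lt_0_compat; lra).
  pose proof (sinh_ge_id _ (Rlt_le _ _ Ht)).
  assert (0 < (4 * (INR (S n) * sinh (disc_hyp_root n / 2 / INR (S n)))) ^ 2); [|lra].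
  apply pow_lt; nra.
Qed.

Lemma disc_eigenvalue_inj (n i j : nat) : (1 <= i <= 2 * S n)%nat -> (1 <= j <= 2 * S n)%nat ->
  disc_eigenvalue n i = disc_eigenvalue n j -> i = j.
Proof.
  intros Hi Hj E.
  apply (node_separated (disc_phase n) (disc_phase n)); try lia.
  { intros; apply disc_phase_spec, disc_node_phase; auto. }
  { intros; apply disc_phase_spec, disc_node_phase; auto. }
  destruct i as [|i]; [lia|]; destruct j as [|j]; [lia|].
  unfold disc_eigenvalue, dilate in E.
  pose proof (disc_node_arg n _ Hi) as Ai; pose proof (disc_node_arg n _ Hj) as Aj.
  pose proof (lt_0_INR (S n) ltac:(lia)) as Hn.
  set (s := node (disc_phase n) (S i)) in *; set (t := node (disc_phase n) (S j)) in *.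
  assert (0 < sin (s / 2 / INR (S n))) by (apply sin_gt_0; lra).
  assert (0 < sin (t / 2 / INR (S n))) by (apply sin_gt_0; lra).
  assert (Es : sin (s / 2 / INR (S n)) = sin (t / 2 / INR (S n))).
  { assert (sin (s / 2 / INR (S n)) ^ 2 = sin (t / 2 / INR (S n)) ^ 2).
    { apply Rmult_eq_reg_l with ((4 * INR (S n)) ^ 2); [|apply pow_nonzero; lra].
      rewrite <- !Rpow_mult_distr, !Rmult_assoc; exact E. }
    nra. }
  apply sin_inj in Es; try lra.
  apply Rmult_eq_reg_r with (/ 2 / INR (S n)).
  - unfold Rdiv in *; rewrite <- !Rmult_assoc; exact Es.
  - apply Rgt_not_eq, Rdiv_lt_0_compat; lra.
Qed.

(** * The discretised polynomial factors over its explicit roots *)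

Lemma cos_multiple_rec (t : R) (n : nat) :
  cos (INR (S (S n)) * t) = 2 * cos t * cos (INR (S n) * t) - cos (INR n * t).
Proof.
  replace (INR (S (S n)) * t) with (INR (S n) * t + t) by (rewrite (S_INR (S n)); ring).
  replace (INR n * t) with (INR (S n) * t - t) by (rewrite (S_INR n); ring).
  rewrite cos_plus, cos_minus; ring.
Qed.

Lemma cosh_plus (x y : R) : cosh (x + y) = cosh x * cosh y + sinh x * sinh y.
Proof. unfold cosh, sinh; rewrite Ropp_plus_distr, !exp_plus; field. Qed.
Lemma cosh_minus (x y : R) : cosh (x - y) = cosh x * cosh y - sinh x * sinh y.
Proof.
  unfold cosh, sinh; replace (- (x - y)) with (- x + y) by ring; unfold Rminus.
  rewrite !exp_plus; field.
Qed.
Lemma sinh_double (x : R) : sinh (2 * x) = 2 * sinh x * cosh x.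
Proof.
  replace (2 * x) with (x + x) by ring.
  unfold cosh, sinh; rewrite Ropp_plus_distr, !exp_plus; field.
Qed.
Lemma cosh_square (x : R) : cosh x ^ 2 = 1 + sinh x ^ 2.
Proof.
  assert (E : exp x * exp (- x) = 1) by (rewrite <- exp_plus, Rplus_opp_r; apply exp_0).
  unfold cosh, sinh.
  replace (1 + ((exp x - exp (- x)) / 2) ^ 2)
    with (1 - exp x * exp (- x) + ((exp x + exp (- x)) / 2) ^ 2) by field.
  rewrite E; ring.
Qed.

Lemma cosh_multiple_rec (t : R) (n : nat) :
  cosh (INR (S (S n)) * t) = 2 * cosh t * cosh (INR (S n) * t) - cosh (INR n * t).
Proof.
  replace (INR (S (S n)) * t) with (INR (S n) * t + t) by (rewrite (S_INR (S n)); ring).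
  replace (INR n * t) with (INR (S n) * t - t) by (rewrite (S_INR n); ring).
  rewrite cosh_plus, cosh_minus; ring.
Qed.

(** For t = z/N and M = 2 N the trigonometric form
    (1 + cos(2 z))/2 + (N/2) sin t sin(2 z) factors as
    cos z (cos z + N sin t sin z). *)
Lemma disc_coef_root (n i : nat) : (i <= 2 * S n)%nat ->
  peval (2 * S n + 2) (disc_coef (INR (2 * S n))) (disc_eigenvalue n i) = 0.
Proof.
  intros Hi.
  pose proof (lt_0_INR (S n) ltac:(lia)) as Hn.
  assert (EM : INR (2 * S n) = 2 * INR (S n)) by (rewrite mult_INR; reflexivity).
  destruct i as [|i].
  - destruct (disc_hyp_root_spec n) as [_ Hx].
    set (x := disc_hyp_root n) in *; set (t := x / INR (S n)).
    assert (Ex : INR (S n) * t = x) by (unfold t; field; lra).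
    rewrite (peval_disc_coef (fun j => cosh (INR j * t)) (cosh t)); try lia.
    + rewrite minus_INR, plus_INR, EM by lia.
      replace (2 * INR (S n) * t) with (2 * x) by (rewrite <- Ex; ring).
      replace ((2 * INR (S n) - INR 1) * t) with (2 * x - t) by (rewrite <- Ex; simpl; ring).
      replace ((2 * INR (S n) + INR 1) * t) with (2 * x + t) by (rewrite <- Ex; simpl; ring).
      rewrite cosh_plus, cosh_minus, sinh_double.
      replace (cosh (2 * x)) with (2 * cosh x ^ 2 - 1).
      2:{ replace (2 * x) with (x + x) by ring; rewrite cosh_plus, cosh_square.
          pose proof (cosh_square x); lra. }
      unfold dilate in Hx; fold t in Hx.
      transitivity (cosh x ^ 2 - INR (S n) * sinh t * sinh x * cosh x); [field|].
      rewrite Hx; ring.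
    + rewrite Rmult_0_l; apply cosh_0.
    + rewrite Rmult_1_l; reflexivity.
    + intros; apply cosh_multiple_rec.
    + unfold disc_eigenvalue, dilate; fold x.
      replace (x / 2 / INR (S n)) with (t / 2) by (unfold t; field; lra).
      replace t with (t / 2 + t / 2) at 2 by field.
      rewrite cosh_plus, EM; pose proof (cosh_square (t / 2)); nra.
  - pose proof (node_equation (dilate sin n) (disc_phase n) (S i)) as Hx.
    set (x := node (disc_phase n) (S i)) in *; set (t := x / INR (S n)).
    assert (Ex : INR (S n) * t = x) by (unfold t; field; lra).
    rewrite (peval_disc_coef (fun j => cos (INR j * t)) (cos t)); try lia.
    + rewrite minus_INR, plus_INR, EM by lia.
      replace (2 * INR (S n) * t) with (2 * x) by (rewrite <- Ex; ring).
      replace ((2 * INR (S n) - INR 1) * t) with (2 * x - t) by (rewrite <- Ex; simpl; ring).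
      replace ((2 * INR (S n) + INR 1) * t) with (2 * x + t) by (rewrite <- Ex; simpl; ring).
      rewrite cos_plus, cos_minus, sin_2a, cos_2a_cos.
      rewrite <- Hx; [unfold dilate; fold t; field|].
      intros E; apply disc_phase_spec; apply (disc_node_phase n (S i)); auto; lia.
    + rewrite Rmult_0_l; apply cos_0.
    + rewrite Rmult_1_l; reflexivity.
    + intros; apply cos_multiple_rec.
    + unfold disc_eigenvalue, dilate; fold x.
      replace (x / 2 / INR (S n)) with (t / 2) by (unfold t; field; lra).
      replace (cos t) with (1 - 2 * sin (t / 2) * sin (t / 2)).
      2:{ rewrite <- cos_2a_sin; f_equal; field. }
      rewrite EM; ring.
Qed.

Definition disc_inverses (n : nat) : list R :=
  / disc_eigenvalue n 0 :: map (fun i => / disc_eigenvalue n i) (seq 1 (2 * S n)).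

Lemma disc_eigenvalue_neq_0 (n i : nat) : (i <= 2 * S n)%nat -> disc_eigenvalue n i <> 0.
Proof.
  intros Hi; destruct i as [|i].
  - apply Rlt_not_eq, disc_eigenvalue_neg.
  - apply Rgt_not_eq, disc_eigenvalue_pos; lia.
Qed.

Lemma NoDup_map_on {T U : Type} (f : T -> U) (l : list T) :
  (forall x y, In x l -> In y l -> f x = f y -> x = y) -> NoDup l -> NoDup (map f l).
Proof.
  induction l as [|a l IH]; intros Hf Hl; simpl; [constructor|].
  inversion Hl as [|? ? Ha Hl']; subst; constructor.
  - intros H; apply in_map_iff in H; destruct H as [b [E Hb]].
    rewrite (Hf b a) in Hb; simpl; auto.
  - apply IH; auto; intros; apply Hf; simpl; auto.
Qed.

Lemma peval_0 (n : nat) (c : nat -> R) : peval (S n) c 0 = c O.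
Proof. simpl; ring. Qed.

(** Both sides have degree at most 2 n + 3 and agree at the 2 n + 3 roots and
    at 0. *)
Lemma prod_coef_disc (n k : nat) : (k < 2 * S n + 2)%nat ->
  prod_coef (disc_inverses n) k = disc_coef (INR (2 * S n)) k.
Proof.
  intros Hk.
  assert (Hlen : S (length (disc_inverses n)) = (2 * S n + 2)%nat).
  { unfold disc_inverses; simpl length; rewrite length_map, length_seq; lia. }
  enough (1 * prod_coef (disc_inverses n) k + (-1) * disc_coef (INR (2 * S n)) k = 0) by lra.
  refine (peval_unique (2 * S n + 2)
    (fun k => 1 * prod_coef (disc_inverses n) k + (-1) * disc_coef (INR (2 * S n)) k)
    (0 :: map (disc_eigenvalue n) (seq 0 (2 * S n + 1))) _ _ _ k Hk).
  - constructor.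
    + intros H; apply in_map_iff in H; destruct H as [i [E Hi]]; apply in_seq in Hi.
      apply (disc_eigenvalue_neq_0 n i); auto; lia.
    + apply NoDup_map_on; [|apply seq_NoDup].
      intros i j Hi Hj E; apply in_seq in Hi; apply in_seq in Hj.
      destruct i as [|i]; destruct j as [|j]; auto.
      * pose proof (disc_eigenvalue_neg n); pose proof (disc_eigenvalue_pos n (S j)).
        exfalso; lapply H0; [lra|lia].
      * pose proof (disc_eigenvalue_neg n); pose proof (disc_eigenvalue_pos n (S i)).
        exfalso; lapply H0; [lra|lia].
      * apply (disc_eigenvalue_inj n); auto; lia.
  - simpl length; rewrite length_map, length_seq; lia.
  - intros x Hx; rewrite peval_linear.
    destruct Hx as [<-|Hx].
    + replace (2 * S n + 2)%nat with (S (2 * S n + 1)) by lia.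
      rewrite !peval_0, prod_coef_0; unfold disc_coef, cheb_coef; simpl; field.
    + apply in_map_iff in Hx; destruct Hx as [i [<- Hi]]; apply in_seq in Hi.
      rewrite disc_coef_root by lia.
      rewrite <- Hlen, (peval_prod_coef_root _ (/ disc_eigenvalue n i)); [ring| |].
      * unfold disc_inverses; destruct i as [|i]; [left; auto|right].
        apply in_map_iff; exists (S i); split; auto; apply in_seq; lia.
      * apply Rinv_l, disc_eigenvalue_neq_0; lia.
Qed.

Lemma is_lim_seq_inv_INR_S : is_lim_seq (fun n => / INR (S n)) 0.
Proof.
  apply (is_lim_seq_inv (fun n => INR (S n)) p_infty); [|discriminate].
  apply (is_lim_seq_incr_1 INR), is_lim_seq_INR.
Qed.

Lemma is_lim_seq_squeeze_0 (u v : nat -> R) :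
  (forall n, Rabs (u n) <= v n) -> is_lim_seq v 0 -> is_lim_seq u 0.
Proof.
  intros H Hv; apply is_lim_seq_abs_0.
  apply (is_lim_seq_le_le (fun _ => 0) _ v); auto.
  - intros n; split; [apply Rabs_pos|apply H].
  - apply is_lim_seq_const.
Qed.

Lemma is_lim_seq_dilate (f : R -> R) (x : nat -> R) (B : R) :
  derivable_pt_lim f 0 1 -> f 0 = 0 -> (forall n, Rabs (x n) <= B) ->
  is_lim_seq (fun n => dilate f n (x n) - x n) 0.
Proof.
  intros Hf H0 HB.
  assert (HB0 : 0 <= B) by (eapply Rle_trans; [apply Rabs_pos|apply (HB O)]).
  apply is_lim_seq_spec; intros eps; simpl.
  assert (He : 0 < eps / (B + 1)) by (apply Rdiv_lt_0_compat; [apply cond_pos|lra]).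
  destruct (Hf _ He) as [d Hd].
  pose proof is_lim_seq_inv_INR_S as HI; apply is_lim_seq_spec in HI.
  assert (Hq : 0 < d / (B + 1)) by (apply Rdiv_lt_0_compat; [apply cond_pos|lra]).
  destruct (HI (mkposreal _ Hq)) as [N HN]; exists N; intros n Hn.
  specialize (HN n Hn); simpl in HN; rewrite Rminus_0_r in HN.
  pose proof (lt_0_INR (S n) ltac:(lia)) as Hp.
  change (match n with O => 1 | S _ => INR n + 1 end) with (INR (S n)) in HN.
  rewrite Rabs_pos_eq in HN by (apply Rlt_le, Rinv_0_lt_compat; auto).
  rewrite Rminus_0_r; unfold dilate.
  destruct (Req_dec (x n) 0) as [E|E].
  { rewrite E; unfold Rdiv; rewrite Rmult_0_l, H0, Rmult_0_r, Rminus_0_r, Rabs_R0.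
    apply cond_pos. }
  set (h := x n / INR (S n)).
  assert (Hh : h <> 0).
  { unfold h, Rdiv; apply Rmult_integral_contrapositive_currified; auto.
    apply Rinv_neq_0_compat; lra. }
  specialize (Hd h Hh); rewrite Rplus_0_l, H0, Rminus_0_r in Hd.
  replace (INR (S n) * f h - x n) with (x n * (f h / h - 1)).
  2:{ unfold h; field; split; lra. }
  rewrite Rabs_mult.
  assert (HL : Rabs h < d).
  { unfold h, Rdiv; rewrite Rabs_mult, (Rabs_pos_eq (/ INR (S n)))
      by (apply Rlt_le, Rinv_0_lt_compat; auto).
    apply Rle_lt_trans with (B * / INR (S n)).
    - apply Rmult_le_compat_r; [apply Rlt_le, Rinv_0_lt_compat; auto|apply HB].
    - apply Rle_lt_trans with ((B + 1) * / INR (S n)).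
      + apply Rmult_le_compat_r; [apply Rlt_le, Rinv_0_lt_compat; auto|lra].
      + replace (pos d) with ((B + 1) * (d / (B + 1))) by (field; lra).
        apply Rmult_lt_compat_l; lra. }
  specialize (Hd HL).
  apply Rle_lt_trans with (B * (eps / (B + 1))).
  - apply Rmult_le_compat; try apply Rabs_pos; [apply HB|lra].
  - replace (pos eps) with ((B + 1) * (eps / (B + 1))) at 2 by (field; lra).
    apply Rmult_lt_compat_r; lra.
Qed.

(** By monotonicity |h| is bounded below away from its zero, so u_n cannot stay
    away from it when h(u_n) tends to 0. *)
Lemma is_lim_seq_root (h : R -> R) (a b x : R) (u : nat -> R) :
  (forall s t, a <= s -> s < t -> t <= b -> h s < h t) ->
  a <= x <= b -> h x = 0 ->
  (forall n, a <= u n <= b) -> is_lim_seq (fun n => h (u n)) 0 -> is_lim_seq u x.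
Proof.
  intros Hh Hx E Hu Hl.
  apply is_lim_seq_spec; intros eps; simpl; pose proof (cond_pos eps) as He.
  apply is_lim_seq_spec in Hl.
  (* h is bounded away from 0 on both sides of the root *)
  assert (R1 : exists d : posreal, forall t, x + eps <= t <= b -> d <= h t).
  { destruct (Rle_dec (x + eps) b) as [L|L].
    - assert (P : 0 < h (x + eps)) by (rewrite <- E; apply Hh; lra).
      exists (mkposreal _ P); intros t [[Ht|<-] Hb]; simpl; [|lra].
      apply Rlt_le, Hh; lra.
    - exists (mkposreal _ Rlt_0_1); intros; lra. }
  assert (R2 : exists d : posreal, forall t, a <= t <= x - eps -> h t <= - d).
  { destruct (Rle_dec a (x - eps)) as [L|L].
    - assert (P : 0 < - h (x - eps)).
      { assert (h (x - eps) < h x) by (apply Hh; lra); lra. }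
      exists (mkposreal _ P); intros t [Ha [Ht|E2]]; simpl; [|rewrite E2; lra].
      assert (h t < h (x - eps)) by (apply Hh; lra); lra.
    - exists (mkposreal _ Rlt_0_1); intros; lra. }
  destruct R1 as [d1 H1]; destruct R2 as [d2 H2].
  destruct (Hl d1) as [N1 HN1]; destruct (Hl d2) as [N2 HN2].
  exists (max N1 N2); intros n Hn.
  specialize (HN1 n ltac:(lia)); specialize (HN2 n ltac:(lia)); simpl in *.
  rewrite Rminus_0_r in *; apply Rabs_lt_between in HN1; apply Rabs_lt_between in HN2.
  specialize (Hu n); apply Rabs_lt_between; split.
  - destruct (Rlt_dec (x - eps) (u n)); [lra|]; specialize (H2 (u n)); lra.
  - destruct (Rlt_dec (u n) (x + eps)); [lra|]; specialize (H1 (u n)); lra.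
Qed.

(** * Passage to the limit *)

Lemma phase_function_increasing (k : nat) (s t : R) : (1 <= k)%nat ->
  0 <= s -> s < t -> t <= PI / 2 ->
  (INR k * PI - s) * sin s - cos s < (INR k * PI - t) * sin t - cos t.
Proof.
  intros Hk Hs Hst Ht; pose proof PI_RGT_0 as HPI.
  assert (Hk1 : 1 <= INR k) by (change 1 with (INR 1); apply le_INR; auto).
  destruct (MVT_cor2 (fun w => (INR k * PI - w) * sin w - cos w)
    (fun w => (INR k * PI - w) * cos w) s t Hst) as [c [E Hc]].
  { intros c _; apply is_derive_Reals; auto_derive; auto; ring. }
  assert (0 < cos c) by (apply cos_gt_0; lra).
  assert (0 < INR k * PI - c) by nra.
  assert (0 < (INR k * PI - c) * cos c * (t - s)); [|lra].
  apply Rmult_lt_0_compat; [apply Rmult_lt_0_compat; auto|lra].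
Qed.

Lemma hyp_function_increasing (s t : R) : 0 <= s -> s < t ->
  s * sinh s - cosh s < t * sinh t - cosh t.
Proof.
  intros Hs Hst.
  destruct (MVT_cor2 (fun x => x * sinh x - cosh x)
    (fun x => 1 * sinh x + x * cosh x - sinh x) s t Hst) as [c [E Hc]].
  { intros c _; apply derivable_pt_lim_minus; [|apply derivable_pt_lim_cosh].
    apply (derivable_pt_lim_mult (fun x => x)); [apply derivable_pt_lim_id|].
    apply derivable_pt_lim_sinh. }
  assert (0 < cosh c).
  { unfold cosh; pose proof (exp_pos c); pose proof (exp_pos (- c)); lra. }
  assert (0 < c * cosh c * (t - s)); [|lra].
  apply Rmult_lt_0_compat; [apply Rmult_lt_0_compat; lra|lra].
Qed.

(** The discrete root almost satisfies the limit equation, the defect being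
    the difference between N sin(z/N) and z. *)
Lemma is_lim_seq_phase (k : nat) : (1 <= k)%nat ->
  is_lim_seq (fun n => disc_phase n k) (limit_phase k).
Proof.
  intros Hk; destruct (limit_phase_spec k Hk) as [Hw Ew]; pose proof PI_RGT_0 as HPI.
  assert (Hk1 : 1 <= INR k) by (change 1 with (INR 1); apply le_INR; auto).
  apply (is_lim_seq_root (fun w => (INR k * PI - w) * sin w - cos w) 0 (PI / 2)).
  - intros s t Hs Hst Ht; apply phase_function_increasing; auto.
  - lra.
  - lra.
  - intros n; apply disc_phase_range.
  - apply is_lim_seq_ext_loc with (fun n =>
      - ((dilate sin n (INR k * PI - disc_phase n k) - (INR k * PI - disc_phase n k))
         * sin (disc_phase n k))).
    { exists k; intros n Hn.
      destruct (disc_phase_spec n k ltac:(lia)) as [_ E]; rewrite <- E; ring. }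
    apply is_lim_seq_squeeze_0 with (fun n =>
      Rabs (dilate sin n (INR k * PI - disc_phase n k) - (INR k * PI - disc_phase n k))).
    { intros n; rewrite Rabs_Ropp, Rabs_mult.
      rewrite <- Rmult_1_r; apply Rmult_le_compat_l; [apply Rabs_pos|].
      apply Rabs_le; pose proof (SIN_bound (disc_phase n k)); lra. }
    apply (proj1 (is_lim_seq_abs_0 _)), (is_lim_seq_dilate sin _ (INR k * PI)).
    + rewrite <- cos_0; apply derivable_pt_lim_sin.
    + apply sin_0.
    + intros n; pose proof (disc_phase_range n k); apply Rabs_le; nra.
Qed.

Lemma is_lim_seq_hyp_root : is_lim_seq disc_hyp_root limit_hyp_root.
Proof.
  destruct limit_hyp_root_spec as [Hw Ew].
  apply (is_lim_seq_root (fun x => x * sinh x - cosh x) 0 2).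
  - intros s t Hs Hst _; apply hyp_function_increasing; auto.
  - lra.
  - lra.
  - intros n; destruct (disc_hyp_root_spec n); lra.
  - apply is_lim_seq_ext with (fun n =>
      - ((dilate sinh n (disc_hyp_root n) - disc_hyp_root n) * sinh (disc_hyp_root n))).
    { intros n; destruct (disc_hyp_root_spec n) as [_ E]; rewrite <- E; ring. }
    apply is_lim_seq_squeeze_0 with (fun n =>
      Rabs (dilate sinh n (disc_hyp_root n) - disc_hyp_root n) * sinh 2).
    { intros n; rewrite Rabs_Ropp, Rabs_mult.
      apply Rmult_le_compat_l; [apply Rabs_pos|].
      destruct (disc_hyp_root_spec n) as [[H1 H2] _].
      pose proof (sinh_ge_id _ (Rlt_le _ _ H1)).
      rewrite Rabs_pos_eq by lra.
      destruct H2 as [H2| ->]; [apply Rlt_le, sinh_lt; auto|lra]. }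
    replace (Finite 0) with (Finite (0 * sinh 2)) by (f_equal; ring).
    apply is_lim_seq_mult'; [|apply is_lim_seq_const].
    apply (proj1 (is_lim_seq_abs_0 _)), (is_lim_seq_dilate sinh _ 2).
    + rewrite <- cosh_0; apply derivable_pt_lim_sinh.
    + apply sinh_0.
    + intros n; destruct (disc_hyp_root_spec n); apply Rabs_le; lra.
Qed.

Lemma is_lim_seq_dilate_half (f : R -> R) (u : nat -> R) (l B : R) :
  derivable_pt_lim f 0 1 -> f 0 = 0 -> (forall n, Rabs (u n) <= B) ->
  is_lim_seq u l -> is_lim_seq (fun n => 4 * dilate f n (u n / 2)) (2 * l).
Proof.
  intros Hf H0 HB Hu.
  apply is_lim_seq_ext with (fun n => 4 * ((dilate f n (u n / 2) - u n / 2) + u n * / 2)).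
  { intros n; field. }
  replace (2 * l) with (4 * (0 + l * / 2)) by field.
  apply is_lim_seq_mult'; [apply is_lim_seq_const|].
  apply is_lim_seq_plus'.
  - apply is_lim_seq_dilate with (B / 2); auto.
    intros n; unfold Rdiv; rewrite Rabs_mult, (Rabs_pos_eq (/ 2)) by lra.
    specialize (HB n); lra.
  - apply is_lim_seq_mult'; [auto|apply is_lim_seq_const].
Qed.

Lemma is_lim_seq_sqr (u : nat -> R) (l : R) :
  is_lim_seq u l -> is_lim_seq (fun n => u n ^ 2) (l ^ 2).
Proof.
  intros H; apply is_lim_seq_ext with (fun n => u n * u n); [intros; ring|].
  replace (l ^ 2) with (l * l) by ring; apply is_lim_seq_mult'; auto.
Qed.

Lemma is_lim_seq_pow_const (u : nat -> R) (l : R) (p : nat) :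
  is_lim_seq u l -> is_lim_seq (fun n => u n ^ p) (l ^ p).
Proof.
  intros H; induction p as [|p IH]; simpl; [apply is_lim_seq_const|].
  apply is_lim_seq_mult'; auto.
Qed.

Lemma is_lim_seq_disc_eigenvalue (i : nat) :
  is_lim_seq (fun n => disc_eigenvalue n i) (eigenvalue_list i).
Proof.
  destruct i as [|i]; unfold disc_eigenvalue, eigenvalue_list.
  - apply (is_lim_seq_opp (fun n => (4 * dilate sinh n (disc_hyp_root n / 2)) ^ 2)
      (Finite ((2 * limit_hyp_root) ^ 2))), is_lim_seq_sqr.
    apply is_lim_seq_dilate_half with 2; [| | |apply is_lim_seq_hyp_root].
    + rewrite <- cosh_0; apply derivable_pt_lim_sinh.
    + apply sinh_0.
    + intros n; destruct (disc_hyp_root_spec n); apply Rabs_le; lra.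
  - apply is_lim_seq_sqr.
    apply is_lim_seq_dilate_half with (INR (S i) * PI / 2 + PI / 2).
    + rewrite <- cos_0; apply derivable_pt_lim_sin.
    + apply sin_0.
    + intros n; unfold node; pose proof PI_RGT_0 as HPI; pose proof (pos_INR (S i)).
      assert (0 <= INR (S i) * PI) by nra.
      pose proof (disc_phase_range n (Nat.div2 (S i))).
      apply Rabs_le; destruct (Nat.even (S i)); lra.
    + unfold node; apply is_lim_seq_minus'; [apply is_lim_seq_const|].
      destruct (Nat.even (S i)) eqn:E; [|apply is_lim_seq_const].
      apply is_lim_seq_phase; apply even_double in E; lia.
Qed.

Lemma limit_node_phase (i : nat) : (1 <= i)%nat -> Nat.even i = true ->
  0 < limit_phase (Nat.div2 i) < PI / 2.
Proof. intros Hi E; apply limit_phase_spec; apply even_double in E; lia. Qed.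

Lemma eigenvalue_list_neg : eigenvalue_list 0 < 0.
Proof.
  unfold eigenvalue_list; destruct limit_hyp_root_spec as [H _].
  assert (0 < (2 * limit_hyp_root) ^ 2) by (apply pow_lt; lra); lra.
Qed.

Lemma limit_node_pos (i : nat) : (1 <= i)%nat -> 0 < node limit_phase i.
Proof.
  intros Hi; eapply Rlt_le_trans; [|apply node_lower; auto; apply limit_node_phase; auto].
  pose proof (lt_0_INR i ltac:(lia)); lra.
Qed.

Lemma eigenvalue_list_pos (i : nat) : 0 < eigenvalue_list (S i).
Proof.
  unfold eigenvalue_list; apply pow_lt.
  pose proof (limit_node_pos (S i) ltac:(lia)); lra.
Qed.

Lemma eigenvalue_list_neq_0 (i : nat) : eigenvalue_list i <> 0.
Proof.
  destruct i; [apply Rlt_not_eq, eigenvalue_list_neg|apply Rgt_not_eq, eigenvalue_list_pos].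
Qed.

Lemma eigenvalue_list_inj (i j : nat) : eigenvalue_list i = eigenvalue_list j -> i = j.
Proof.
  intros E; pose proof eigenvalue_list_neg as H0.
  destruct i as [|i]; destruct j as [|j]; auto.
  - pose proof (eigenvalue_list_pos j); lra.
  - pose proof (eigenvalue_list_pos i); lra.
  - apply (node_separated limit_phase limit_phase); try lia;
      try (apply limit_node_phase; lia).
    pose proof (limit_node_pos (S i) ltac:(lia)); pose proof (limit_node_pos (S j) ltac:(lia)).
    unfold eigenvalue_list in E; nra.
Qed.

Lemma ex_series_inv_square : ex_series (fun i => / INR (S i) ^ 2).
Proof.
  apply (ex_series_le (K := R_AbsRing) (V := R_CompleteNormedModule))
    with (fun i => 2 * (/ INR (S i) - / INR (S (S i)))).
  - intros i; unfold norm; simpl norm; change (Rabs (/ INR (S i) ^ 2) <=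
      2 * (/ INR (S i) - / INR (S (S i)))).
    pose proof (lt_0_INR (S i) ltac:(lia)) as H; rewrite (S_INR (S i)).
    assert (H1 : 1 <= INR (S i)) by (change 1 with (INR 1); apply le_INR; lia).
    set (x := INR (S i)) in *.
    rewrite Rabs_pos_eq by (apply Rlt_le, Rinv_0_lt_compat, pow_lt; auto).
    replace (2 * (/ x - / (x + 1))) with (/ x ^ 2 * (2 * x / (x + 1))) by (field; lra).
    rewrite <- Rmult_1_r at 1; apply Rmult_le_compat_l.
    + apply Rlt_le, Rinv_0_lt_compat, pow_lt; auto.
    + apply Rmult_le_reg_r with (x + 1); [lra|]; unfold Rdiv; field_simplify; lra.
  - exists 2.
    change (is_lim_seq (sum_n (fun i => 2 * (/ INR (S i) - / INR (S (S i))))) 2).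
    apply is_lim_seq_ext with (fun n => 2 * (1 - / INR (S (S n)))).
    + intros n; induction n as [|n IH]; [rewrite sum_O; simpl; eqR; field|].
      rewrite sum_Sn, <- IH; unfold plus; simpl AbelianMonoid.sort; eqR.
      change (2 * (1 - / INR (S (S (S n)))) = 2 * (1 - / INR (S (S n))) +
        2 * (/ INR (S (S n)) - / INR (S (S (S n))))); ring.
    + replace (Finite 2) with (Finite (2 * (1 - 0))) by (f_equal; ring).
      apply is_lim_seq_mult'; [apply is_lim_seq_const|].
      apply is_lim_seq_minus'; [apply is_lim_seq_const|].
      apply (is_lim_seq_incr_1 (fun n => / INR (S n))), is_lim_seq_inv_INR_S.
Qed.

Lemma is_lim_seq_sum_n (a : nat -> nat -> R) (l : nat -> R) (m : nat) :
  (forall i, (i <= m)%nat -> is_lim_seq (fun n => a n i) (l i)) ->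
  is_lim_seq (fun n => sum_n (a n) m) (sum_n l m).
Proof.
  induction m as [|m IH]; intros H.
  - rewrite sum_O; apply is_lim_seq_ext with (fun n => a n O); [|apply H; lia].
    intros; now rewrite sum_O.
  - rewrite sum_Sn; apply is_lim_seq_ext with (fun n => sum_n (a n) m + a n (S m)).
    { intros; now rewrite sum_Sn. }
    apply is_lim_seq_plus'; [apply IH; intros; apply H; lia|apply H; lia].
Qed.

Lemma Rabs_sum_n_m_le (a b : nat -> R) (n m : nat) :
  (forall i, Rabs (a i) <= b i) -> Rabs (sum_n_m a n m) <= sum_n_m b n m.
Proof.
  intros H; eapply Rle_trans.
  - exact (norm_sum_n_m (K := R_AbsRing) (V := R_NormedModule) a n m).
  - apply sum_n_m_le; exact H.
Qed.

Lemma sum_n_split (a : nat -> R) (n m : nat) : (n <= m)%nat ->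
  sum_n a m = sum_n a n + sum_n_m a (S n) m.
Proof. intros H; apply (sum_n_m_Chasles a 0 n m); lia. Qed.

(** Tannery's theorem: dominated convergence for series, with a growing number of
    terms. *)
Lemma tannery (a : nat -> nat -> R) (l b : nat -> R) (m : nat -> nat) :
  ex_series b -> (forall n i, Rabs (a n i) <= b i) ->
  (forall i, is_lim_seq (fun n => a n i) (l i)) -> (forall n, (n <= m n)%nat) ->
  ex_series l /\ is_lim_seq (fun n => sum_n (a n) (m n)) (Series l).
Proof.
  intros Hb Hab Hl Hm.
  assert (Hlb : forall i, Rabs (l i) <= b i).
  { intros i.
    apply (is_lim_seq_le (fun n => Rabs (a n i)) (fun _ => b i) (Finite _) (Finite _)); auto.
    - exact (is_lim_seq_abs _ _ (Hl i)).
    - apply is_lim_seq_const. }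
  assert (Hs : ex_series l)
    by exact (ex_series_le (K := R_AbsRing) (V := R_CompleteNormedModule) l b Hlb Hb).
  split; auto.
  apply is_lim_seq_spec; intros eps; simpl.
  pose proof (cond_pos eps) as He.
  assert (He4 : 0 < eps / 4) by lra.
  destruct (Cauchy_ex_series (V := R_CompleteNormedModule) b Hb (mkposreal _ He4)) as [I HI].
  simpl in HI.
  assert (Htail : forall j, sum_n_m b (S I) j < eps / 4).
  { intros j; destruct (le_lt_dec I j).
    - specialize (HI (S I) j ltac:(lia) ltac:(lia)).
      apply Rle_lt_trans with (2 := HI); apply Rle_abs.
    - rewrite sum_n_m_zero by lia; unfold zero; simpl; lra. }
  pose proof (is_lim_seq_sum_n a l I (fun i _ => Hl i)) as HF.
  apply is_lim_seq_spec in HF; destruct (HF (mkposreal _ He4)) as [N HN]; simpl in HN.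
  (* the tail of the limit series is dominated too *)
  assert (HR : Rabs (Series l - sum_n l I) <= eps / 4).
  { assert (L : is_lim_seq (fun j => Rabs (sum_n l j - sum_n l I)) (Rabs (Series l - sum_n l I))).
    { apply (is_lim_seq_abs _ (Finite _)), is_lim_seq_minus'; [|apply is_lim_seq_const].
      exact (Series_correct l Hs). }
    apply (is_lim_seq_le_loc _ (fun _ => eps / 4) (Finite _) (Finite _)) with (2 := L).
    2: apply is_lim_seq_const.
    exists I; intros j Hj.
    replace (sum_n l j - sum_n l I) with (sum_n_m l (S I) j).
    { eapply Rle_trans; [apply (Rabs_sum_n_m_le l b); auto|apply Rlt_le, Htail]. }
    rewrite (sum_n_split l I j Hj); symmetry; eqR; ring. }
  exists (max N I); intros n Hn.
  specialize (HN n ltac:(lia)).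
  rewrite (sum_n_split (a n) I (m n)) by (specialize (Hm n); lia).
  pose proof (Rabs_sum_n_m_le (a n) b (S I) (m n) (Hab n)).
  pose proof (Htail (m n)).
  replace (sum_n (a n) I + sum_n_m (a n) (S I) (m n) - Series l) with
    ((sum_n (a n) I - sum_n l I) + sum_n_m (a n) (S I) (m n) - (Series l - sum_n l I)) by (eqR; ring).
  eapply Rle_lt_trans; [apply Rabs_triang|]; rewrite Rabs_Ropp.
  eapply Rle_lt_trans; [apply Rplus_le_compat_r, Rabs_triang|]; lra.
Qed.

Lemma power_sum_seq (f : nat -> R) (p m : nat) :
  power_sum (map f (seq 1 (S m))) p = sum_n (fun i => f (S i) ^ p) m.
Proof.
  assert (G : forall l x, power_sum (l ++ x :: nil) p = power_sum l p + x ^ p).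
  { induction l as [|y l IH]; intros x; simpl; [ring|rewrite IH; ring]. }
  induction m as [|m IH]; [rewrite sum_O; simpl; ring|].
  rewrite seq_S, map_app, sum_Sn, <- IH.
  exact (G _ _).
Qed.

(** The negative root is split off: the domination by 9/i^2 holds for the
    positive ones. *)
Lemma power_sum_limit (p : nat) : (1 <= p)%nat ->
  ex_series (fun i => (/ eigenvalue_list i) ^ p) /\
  is_lim_seq (fun n => power_sum (disc_inverses n) p)
    (Series (fun i => (/ eigenvalue_list i) ^ p)).
Proof.
  intros Hp.
  assert (HL : forall i, is_lim_seq (fun n => (/ disc_eigenvalue n i) ^ p)
    ((/ eigenvalue_list i) ^ p)).
  { intros i; apply is_lim_seq_pow_const.
    apply (is_lim_seq_inv _ (Finite _)); [apply is_lim_seq_disc_eigenvalue|].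
    intros E; injection E; apply eigenvalue_list_neq_0. }
  destruct (tannery
    (fun n i => if le_dec i (2 * n + 1) then (/ disc_eigenvalue n (S i)) ^ p else 0)
    (fun i => (/ eigenvalue_list (S i)) ^ p)
    (fun i => 9 ^ p * / INR (S i) ^ 2) (fun n => (2 * n + 1)%nat)) as [HS HT].
  - apply (ex_series_scal (K := R_AbsRing) (V := R_NormedModule) (9 ^ p)), ex_series_inv_square.
  - intros n i.
    pose proof (lt_0_INR (S i) ltac:(lia)) as Hi.
    assert (H2 : 0 < / INR (S i) ^ 2) by (apply Rinv_0_lt_compat, pow_lt; auto).
    destruct (le_dec i (2 * n + 1)) as [L|L].
    + pose proof (disc_eigenvalue_pos n (S i) ltac:(lia)) as Hpos.
      pose proof (disc_eigenvalue_lower n (S i) ltac:(lia)) as Hlow.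
      rewrite Rabs_pos_eq by (apply Rlt_le, pow_lt, Rinv_0_lt_compat; auto).
      apply Rle_trans with ((9 * / INR (S i) ^ 2) ^ p).
      * apply pow_incr; split; [apply Rlt_le, Rinv_0_lt_compat; auto|].
        replace (9 * / INR (S i) ^ 2) with (/ (INR (S i) / 3) ^ 2) by (field; lra).
        apply Rinv_le_contravar; auto; apply pow_lt; lra.
      * rewrite Rpow_mult_distr; apply Rmult_le_compat_l; [apply pow_le; lra|].
        destruct p as [|p]; [lia|]; rewrite <- tech_pow_Rmult.
        apply Rle_trans with (/ INR (S i) ^ 2 * 1); [|lra].
        apply Rmult_le_compat_l; [lra|].
        rewrite <- (pow1 p); apply pow_incr; split; [lra|].
        rewrite <- Rinv_1; apply Rinv_le_contravar; [lra|].
        rewrite <- (pow1 2); apply pow_incr; split; [lra|].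
        change 1 with (INR 1); apply le_INR; lia.
    + rewrite Rabs_R0; apply Rmult_le_pos; [apply pow_le; lra|lra].
  - intros i; apply is_lim_seq_ext_loc with (2 := HL (S i)).
    exists i; intros n Hn; destruct (le_dec i (2 * n + 1)); [auto|lia].
  - intros; lia.
  - assert (HX : ex_series (fun i => (/ eigenvalue_list i) ^ p))
      by (apply ex_series_incr_1; exact HS).
    split; auto.
    rewrite (Series_incr_1 _ HX).
    apply is_lim_seq_ext with (fun n => (/ disc_eigenvalue n 0) ^ p +
      sum_n (fun i => if le_dec i (2 * n + 1) then (/ disc_eigenvalue n (S i)) ^ p else 0)
        (2 * n + 1)).
    + intros n; unfold disc_inverses; replace (2 * S n)%nat with (S (2 * n + 1)) by lia.
      cbn [power_sum]; rewrite power_sum_seq; f_equal.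
      apply sum_n_m_ext_loc; intros i Hi; destruct (le_dec i (2 * n + 1)); [auto|lia].
    + apply is_lim_seq_plus'; auto.
Qed.

Definition eigen_power_sum (p : nat) : R := Series (fun i => (/ eigenvalue_list i) ^ p).

Lemma prod_coef_limit (k : nat) : is_lim_seq (fun n => prod_coef (disc_inverses n) k) (char_coef k).
Proof.
  apply is_lim_seq_ext_loc with (fun n => disc_coef (INR (2 * S n)) k).
  - exists k; intros n Hn; symmetry; apply prod_coef_disc; lia.
  - apply is_lim_seq_disc_coef.
    + intros n; apply not_0_INR; lia.
    + apply is_lim_seq_ext with (fun n => / 4 * (/ INR (S n) * / INR (S n))).
      { intros n; rewrite mult_INR; change (INR 2) with 2; field; apply not_0_INR; lia. }
      replace (Finite 0) with (Finite (/ 4 * (0 * 0))) by (f_equal; ring).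
      apply is_lim_seq_mult'; [apply is_lim_seq_const|].
      apply is_lim_seq_mult'; apply is_lim_seq_inv_INR_S.
Qed.

(** The limit of Newton's identities for the finite products. *)
Lemma newton_sum_eigenvalues (q : nat) :
  newton_sum char_coef eigen_power_sum q = - INR (S q) * char_coef (S q).
Proof.
  assert (H1 : is_lim_seq (fun n =>
      newton_sum (prod_coef (disc_inverses n)) (power_sum (disc_inverses n)) q)
    (newton_sum char_coef eigen_power_sum q)).
  { apply is_lim_seq_sum_n; intros k Hk; apply is_lim_seq_mult'.
    - apply prod_coef_limit.
    - apply power_sum_limit; lia. }
  assert (H2 : is_lim_seq (fun n =>
      newton_sum (prod_coef (disc_inverses n)) (power_sum (disc_inverses n)) q)
    (- INR (S q) * char_coef (S q))).
  { apply is_lim_seq_ext with (fun n => - INR (S q) * prod_coef (disc_inverses n) (S q)).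
    { intros n; symmetry; apply newton_identities. }
    apply is_lim_seq_mult'; [apply is_lim_seq_const|apply prod_coef_limit]. }
  apply is_lim_seq_unique in H1; apply is_lim_seq_unique in H2.
  rewrite H1 in H2; injection H2; auto.
Qed.

(** * Rearrangement of absolutely convergent series *)

Definition lsum (h : R -> R) (l : list R) : R := fold_right (fun x s => h x + s) 0 l.

Lemma lsum_app (h : R -> R) (l m : list R) : lsum h (l ++ m) = lsum h l + lsum h m.
Proof. induction l as [|x l IH]; simpl; [ring|rewrite IH; ring]. Qed.

Lemma lsum_Permutation (h : R -> R) (l m : list R) : Permutation l m -> lsum h l = lsum h m.
Proof. induction 1; simpl; lra. Qed.

Lemma lsum_Rabs (h : R -> R) (l : list R) : Rabs (lsum h l) <= lsum (fun x => Rabs (h x)) l.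
Proof.
  induction l as [|x l IH]; simpl; [rewrite Rabs_R0; lra|].
  eapply Rle_trans; [apply Rabs_triang|lra].
Qed.

Lemma incl_Permutation_app {T : Type} (l m : list T) : NoDup l -> incl l m ->
  exists r, Permutation m (l ++ r).
Proof.
  revert m; induction l as [|x l IH]; intros m Hl Hm; [exists m; simpl; auto|].
  inversion Hl as [|? ? Hx Hl']; subst.
  destruct (in_split x m (Hm x (or_introl eq_refl))) as [m1 [m2 ->]].
  destruct (IH (m1 ++ m2)) as [r Hr]; auto.
  - intros y Hy; specialize (Hm y (or_intror Hy)).
    apply in_app_iff in Hm; apply in_app_iff; destruct Hm as [Hm|[Hm|Hm]]; auto.
    subst; contradiction.
  - exists r; simpl; rewrite <- Hr; symmetry; apply Permutation_middle.
Qed.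

(** Up to a permutation m is l followed by a remainder, to which the triangle
    inequality applies. *)
Lemma lsum_incl (h : R -> R) (l m : list R) : NoDup l -> incl l m ->
  Rabs (lsum h m - lsum h l) <= lsum (fun x => Rabs (h x)) m - lsum (fun x => Rabs (h x)) l.
Proof.
  intros Hl Hm; destruct (incl_Permutation_app l m Hl Hm) as [r Hr].
  rewrite !(fun h => lsum_Permutation h _ _ Hr), !lsum_app.
  replace (lsum h l + lsum h r - lsum h l) with (lsum h r) by ring.
  pose proof (lsum_Rabs h r); lra.
Qed.

Lemma lsum_map_seq (h : R -> R) (u : nat -> R) (n : nat) :
  lsum h (map u (seq 0 (S n))) = sum_n (fun i => h (u i)) n.
Proof.
  induction n as [|n IH]; [rewrite sum_O; simpl; ring|].
  rewrite seq_S, map_app, lsum_app, IH, sum_Sn; simpl.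
  rewrite Rplus_0_r; reflexivity.
Qed.

Lemma incl_initial_segments (u v : nat -> R) : (forall i, exists n, u n = v i) ->
  forall N, exists M, forall m, (M <= m)%nat ->
    incl (map v (seq 0 (S N))) (map u (seq 0 (S m))).
Proof.
  intros H N; induction N as [|N [M HM]].
  - destruct (H O) as [n Hn]; exists n; intros m Hm x [<-|[]].
    rewrite <- Hn; apply in_map, in_seq; lia.
  - destruct (H (S N)) as [n Hn]; exists (max M n); intros m Hm x Hx.
    rewrite seq_S, map_app in Hx; apply in_app_iff in Hx; destruct Hx as [Hx|[<-|[]]].
    + apply (HM m ltac:(lia)) in Hx; auto.
    + change (0 + S N)%nat with (S N); rewrite <- Hn; apply in_map, in_seq; lia.
Qed.

(** Two injective enumerations of one set: an initial segment of u that contains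
    a long segment of v is itself contained in a longer segment of v, so the sums
    differ by at most a tail of the absolutely convergent series. *)
Lemma is_series_rearrange (u v : nat -> R) (h : R -> R) :
  (forall m n, u m = u n -> m = n) -> (forall m n, v m = v n -> m = n) ->
  (forall i, exists n, u n = v i) -> (forall n, exists i, v i = u n) ->
  ex_series (fun i => Rabs (h (v i))) ->
  is_series (fun n => h (u n)) (Series (fun i => h (v i))).
Proof.
  intros Hu Hv Huv Hvu Habs.
  change (is_lim_seq (sum_n (fun n => h (u n))) (Series (fun i => h (v i)))).
  apply is_lim_seq_spec; intros eps; simpl; pose proof (cond_pos eps) as He.
  pose proof (Series_correct _ (ex_series_Rabs _ Habs)) as HS.
  change (is_lim_seq (sum_n (fun n => h (v n))) (Series (fun i => h (v i)))) in HS.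
  apply is_lim_seq_spec in HS.
  assert (He2 : 0 < eps / 2) by lra.
  destruct (HS (mkposreal _ He2)) as [N1 HN1]; simpl in HN1.
  destruct (Cauchy_ex_series (V := R_CompleteNormedModule) _ Habs (mkposreal _ He2)) as [N2 HN2].
  simpl in HN2.
  set (N := max N1 N2).
  destruct (incl_initial_segments u v Huv N) as [M HM]; exists M; intros m Hm.
  destruct (incl_initial_segments v u Hvu m) as [J0 HJ].
  set (J := max J0 N).
  assert (D1 : NoDup (map v (seq 0 (S N)))).
  { apply NoDup_map_on; [intros x y _ _; apply Hv|apply seq_NoDup]. }
  assert (D2 : NoDup (map u (seq 0 (S m)))).
  { apply NoDup_map_on; [intros x y _ _; apply Hu|apply seq_NoDup]. }
  pose proof (lsum_incl h _ _ D1 (HM m Hm)) as E1.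
  rewrite !lsum_map_seq in E1.
  assert (E4 : sum_n_m (fun i => Rabs (h (v i))) (S N) J < eps / 2).
  { destruct (le_lt_dec (S N) J).
    - apply Rle_lt_trans with (2 := HN2 (S N) J ltac:(lia) ltac:(lia)); apply Rle_abs.
    - rewrite sum_n_m_zero by lia; unfold zero; simpl; lra. }
  specialize (HN1 N ltac:(lia)).
  assert (E5 : sum_n (fun i => Rabs (h (u i))) m <= sum_n (fun i => Rabs (h (v i))) N +
    sum_n_m (fun i => Rabs (h (v i))) (S N) J).
  { destruct (incl_Permutation_app _ _ D2 (HJ J ltac:(unfold J; lia))) as [r Hr].
    pose proof (lsum_Permutation (fun x => Rabs (h x)) _ _ Hr) as P.
    rewrite lsum_app, !lsum_map_seq in P.
    rewrite (sum_n_split (fun i => Rabs (h (v i))) N J) in P by (unfold J; lia).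
    pose proof (lsum_Rabs h r); pose proof (Rabs_pos (lsum h r)); lra. }
  replace (sum_n (fun n => h (u n)) m - Series (fun i => h (v i))) with
    ((sum_n (fun n => h (u n)) m - sum_n (fun i => h (v i)) N) +
     (sum_n (fun i => h (v i)) N - Series (fun i => h (v i)))) by (eqR; ring).
  eapply Rle_lt_trans; [apply Rabs_triang|]; lra.
Qed.

(** * The eigenvalues of the boundary value problem *)

Definition open01 (x : R) : Prop := 0 < x < 1.

Lemma adhDa_open01 (e : R) : I01 e -> adhDa (D_x open01 e) e.
Proof.
  intros [H0 H1] alp Ha.
  set (d := Rmin (alp / 2) (/ 4)).
  assert (Hd : 0 < d) by (apply Rmin_pos; lra).
  assert (Hd1 : d <= alp / 2) by apply Rmin_l.
  assert (Hd2 : d <= / 4) by apply Rmin_r.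
  destruct (Rle_dec e (/ 2)).
  - exists (e + d); unfold D_x, open01, Rdist; repeat split; try lra.
    replace (e + d - e) with d by ring; rewrite Rabs_pos_eq; lra.
  - exists (e - d); unfold D_x, open01, Rdist; repeat split; try lra.
    replace (e - d - e) with (- d) by ring; rewrite Rabs_Ropp, Rabs_pos_eq; lra.
Qed.

Lemma D_in_of_is_derive (g dg : R -> R) (D : R -> Prop) (x : R) :
  is_derive g x (dg x) -> D_in g dg D x.
Proof.
  intros H; apply (D_in_imp _ _ no_cond); [intros; exact I|].
  apply derivable_pt_lim_D_in, is_derive_Reals, H.
Qed.

Lemma is_derive_of_D_in (f df : R -> R) (x : R) :
  open01 x -> D_in f df I01 x -> is_derive f x (df x).
Proof.
  intros [H0 H1] H; apply is_derive_Reals; intros eps He.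
  destruct (H eps He) as [alp [Ha Hd]].
  set (d := Rmin alp (Rmin x (1 - x))).
  assert (Hp : 0 < d) by (repeat apply Rmin_pos; lra).
  assert (D1 : d <= alp) by apply Rmin_l.
  assert (D2 : d <= x) by (eapply Rle_trans; [apply Rmin_r|apply Rmin_l]).
  assert (D3 : d <= 1 - x) by (eapply Rle_trans; [apply Rmin_r|apply Rmin_r]).
  exists (mkposreal _ Hp); intros t Ht0 Ht; simpl in Ht.
  assert (Hb : - d < t < d) by (apply Rabs_lt_between; auto).
  specialize (Hd (x + t)); simpl in Hd; unfold Rdist in Hd.
  replace (x + t - x) with t in Hd by ring.
  apply Hd; split; [|lra].
  unfold D_x, I01; repeat split; try lra.
Qed.

(** Transfers values and one-sided derivatives to the end points, where the
    differential equation is not assumed. *)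
Lemma D_in_agree (f df g dg : R -> R) (e : R) : I01 e ->
  D_in f df I01 e -> is_derive g e (dg e) -> (forall x, open01 x -> f x = g x) ->
  f e = g e /\ df e = dg e.
Proof.
  intros He Hf Hg E.
  assert (Hsub : forall x, D_x open01 e x -> D_x I01 e x).
  { unfold D_x, open01, I01; intros x [[Hx1 Hx2] Hx3]; split; auto; lra. }
  assert (Hg' : D_in g dg open01 e) by (apply D_in_of_is_derive; auto).
  assert (Ev : f e = g e).
  { apply (single_limit f (D_x open01 e) _ _ e (adhDa_open01 e He)).
    - apply (limit1_imp f (D_x I01 e)); auto; apply (cont_deriv f df); auto.
    - apply limit1_ext with g; [intros x [Hx _]; symmetry; auto|].
      apply (cont_deriv g dg); auto. }
  split; auto.
  apply (single_limit (fun x => (f x - f e) / (x - e)) (D_x open01 e) _ _ e (adhDa_open01 e He)).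
  - apply (limit1_imp _ (D_x I01 e)); auto.
  - apply limit1_ext with (fun x => (g x - g e) / (x - e)); [|apply Hg'].
    intros x [Hx _]; rewrite E, Ev by auto; reflexivity.
Qed.

Lemma constant_on_open01 (f : R -> R) (x : R) :
  (forall t, open01 t -> is_derive f t 0) -> open01 x -> f x = f (/ 2).
Proof.
  intros H [H0 H1].
  destruct (Rtotal_order x (/ 2)) as [L|[->|L]]; auto.
  - apply (eq_is_derive (V := R_NormedModule) f x (/ 2)); auto.
    intros t Ht; apply H; unfold open01; lra.
  - symmetry; apply (eq_is_derive (V := R_NormedModule) f (/ 2) x); auto.
    intros t Ht; apply H; unfold open01; lra.
Qed.

(** The solutions of - u'' = l u with initial data (1,0) and (0,1); a common
    interface for l positive, zero and negative. *)
Record fundamental_pair (l : R) (c s : R -> R) : Prop := {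
  fp_c0 : c 0 = 1;
  fp_s0 : s 0 = 0;
  fp_dc : forall x, is_derive c x (- l * s x);
  fp_ds : forall x, is_derive s x (c x);
  fp_energy : forall x, c x ^ 2 + l * s x ^ 2 = 1 }.

Lemma is_derive_fp_comb (l : R) (c s : R -> R) (a b x : R) : fundamental_pair l c s ->
  is_derive (fun x => a * c x + b * s x) x (- a * l * s x + b * c x).
Proof.
  intros H; pose proof (fp_dc _ _ _ H) as Dc; pose proof (fp_ds _ _ _ H) as Ds.
  auto_derive; [repeat split; eexists; eauto|].
  rewrite (is_derive_unique (fun x : R => c x) _ _ (Dc x)),
    (is_derive_unique (fun x : R => s x) _ _ (Ds x)); ring.
Qed.

Lemma is_derive_fp_comb' (l : R) (c s : R -> R) (a b x : R) : fundamental_pair l c s ->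
  is_derive (fun x => - a * l * s x + b * c x) x (- l * (a * c x + b * s x)).
Proof.
  intros H; pose proof (fp_dc _ _ _ H) as Dc; pose proof (fp_ds _ _ _ H) as Ds.
  auto_derive; [repeat split; eexists; eauto|].
  rewrite (is_derive_unique (fun x : R => c x) _ _ (Dc x)),
    (is_derive_unique (fun x : R => s x) _ _ (Ds x)); ring.
Qed.

(** Variation of constants: c phi - s phi' and l s phi + c phi' have zero
    derivative inside the interval, and [fp_energy] inverts the system. *)
Lemma solution_form (l : R) (c s phi dphi : R -> R) : fundamental_pair l c s ->
  (forall x, I01 x -> D_in phi dphi I01 x) ->
  (forall x, 0 < x < 1 -> ex_derive dphi x /\ - Derive dphi x = l * phi x) ->
  exists a b, forall x, I01 x ->
    phi x = a * c x + b * s x /\ dphi x = - a * l * s x + b * c x.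
Proof.
  intros H H1 H2.
  pose proof (fp_dc _ _ _ H) as Dc; pose proof (fp_ds _ _ _ H) as Ds.
  assert (D1 : forall x, open01 x -> is_derive phi x (dphi x)).
  { intros x Hx; apply is_derive_of_D_in; auto; apply H1; unfold open01, I01 in *; lra. }
  assert (D2 : forall x, open01 x -> is_derive dphi x (- l * phi x)).
  { intros x Hx; destruct (H2 x Hx) as [He Hd].
    replace (- l * phi x) with (Derive dphi x) by lra; apply Derive_correct; auto. }
  set (p := fun x => c x * phi x - s x * dphi x).
  set (q := fun x => l * s x * phi x + c x * dphi x).
  assert (Hp : forall x, open01 x -> p x = p (/ 2)).
  { intros x Hx; apply constant_on_open01; auto; intros t Ht; unfold p.
    auto_derive; [repeat split; eexists; eauto|].
    rewrite (is_derive_unique (fun x : R => c x) _ _ (Dc t)),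
      (is_derive_unique (fun x : R => s x) _ _ (Ds t)),
      (is_derive_unique (fun x : R => phi x) _ _ (D1 t Ht)),
      (is_derive_unique (fun x : R => dphi x) _ _ (D2 t Ht)); ring. }
  assert (Hq : forall x, open01 x -> q x = q (/ 2)).
  { intros x Hx; apply constant_on_open01; auto; intros t Ht; unfold q.
    auto_derive; [repeat split; eexists; eauto|].
    rewrite (is_derive_unique (fun x : R => c x) _ _ (Dc t)),
      (is_derive_unique (fun x : R => s x) _ _ (Ds t)),
      (is_derive_unique (fun x : R => phi x) _ _ (D1 t Ht)),
      (is_derive_unique (fun x : R => dphi x) _ _ (D2 t Ht)); ring. }
  exists (p (/ 2)), (q (/ 2)); intros x Hx.
  apply (D_in_agree phi dphi (fun x => p (/ 2) * c x + q (/ 2) * s x)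
    (fun x => - p (/ 2) * l * s x + q (/ 2) * c x)); auto.
  - apply is_derive_fp_comb; auto.
  - intros t Ht; rewrite <- (Hp t Ht), <- (Hq t Ht); unfold p, q.
    pose proof (fp_energy _ _ _ H t) as En.
    transitivity ((c t ^ 2 + l * s t ^ 2) * phi t); [rewrite En|]; ring.
Qed.

(** On a c + b s the boundary conditions are two linear equations in (a,b) whose
    determinant is (1 + c)^2 + l s (1 + s) at 1, that is 2 + 2 c + l s by
    [fp_energy]. *)
Lemma eigenvalue_iff (l : R) (c s : R -> R) : fundamental_pair l c s ->
  is_eigenvalue l <-> 2 + 2 * c 1 + l * s 1 = 0.
Proof.
  intros H; pose proof (fp_energy _ _ _ H 1) as En.
  pose proof (fp_c0 _ _ _ H) as C0; pose proof (fp_s0 _ _ _ H) as S0.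
  split.
  - intros [phi [[x0 [Hx0 Hphi]] [dphi [H1 [H2 [B1 B2]]]]]].
    destruct (solution_form l c s phi dphi H H1 H2) as [a [b F]].
    destruct (F 0) as [F1 F2]; [unfold I01; lra|].
    destruct (F 1) as [F3 F4]; [unfold I01; lra|].
    rewrite C0, S0 in F1, F2.
    set (c1 := c 1) in *; set (s1 := s 1) in *.
    assert (G1 : b * (1 + c1) = a * l * s1) by lra.
    assert (G2 : a * (1 + c1) + b * (1 + s1) = 0) by lra.
    assert (Hab : a <> 0 \/ b <> 0).
    { destruct (Req_dec a 0); [|auto]; destruct (Req_dec b 0); [|auto]; exfalso.
      apply Hphi; rewrite (proj1 (F x0 Hx0)); subst; ring. }
    replace (2 + 2 * c1 + l * s1) with ((1 + c1) ^ 2 + l * s1 * (1 + s1))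
      by (transitivity (1 + 2 * c1 + l * s1 + (c1 ^ 2 + l * s1 ^ 2)); [ring|rewrite En; ring]).
    destruct Hab as [Ha|Hb].
    + apply Rmult_eq_reg_l with a; auto.
      transitivity ((1 + c1) * (a * (1 + c1)) + a * l * s1 * (1 + s1)); [ring|].
      rewrite <- G1; transitivity ((1 + c1) * (a * (1 + c1) + b * (1 + s1))); [ring|].
      rewrite G2; ring.
    + apply Rmult_eq_reg_l with b; auto.
      transitivity ((1 + c1) * (b * (1 + c1)) + l * s1 * (b * (1 + s1))); [ring|].
      rewrite G1; transitivity (l * s1 * (a * (1 + c1) + b * (1 + s1))); [ring|].
      rewrite G2; ring.
  - intros Hdet.
    assert (Hab : exists a b, a <> 0 /\ b * (1 + c 1) = a * l * s 1 /\
      a * (1 + c 1) + b * (1 + s 1) = 0).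
    { destruct (Req_dec (1 + c 1) 0) as [E|E].
      - exists 1, 0; repeat split; nra.
      - exists (1 + c 1), (l * s 1); repeat split; auto; nra. }
    destruct Hab as [a [b [Ha [G1 G2]]]].
    exists (fun x => a * c x + b * s x); split.
    { exists 0; split; [unfold I01; lra|rewrite C0, S0; lra]. }
    exists (fun x => - a * l * s x + b * c x); repeat split.
    + intros x _; apply D_in_of_is_derive, is_derive_fp_comb; auto.
    + eexists; apply (is_derive_fp_comb' l c s a b x H).
    + rewrite (is_derive_unique (fun x : R => - a * l * s x + b * c x) _ _
        (is_derive_fp_comb' l c s a b x H)); ring.
    + rewrite C0, S0; lra.
    + rewrite C0, S0; lra.
Qed.

Lemma fundamental_pair_pos (w : R) : 0 < w ->
  fundamental_pair (w ^ 2) (fun x => cos (w * x)) (fun x => sin (w * x) / w).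
Proof.
  intros Hw; split.
  - rewrite Rmult_0_r; apply cos_0.
  - rewrite Rmult_0_r, sin_0; field; lra.
  - intros x; auto_derive; auto; field; lra.
  - intros x; auto_derive; auto; field; lra.
  - intros x; pose proof (sin2_cos2 (w * x)); unfold Rsqr in *.
    transitivity (sin (w * x) * sin (w * x) + cos (w * x) * cos (w * x)); [field; lra|auto].
Qed.

Lemma fundamental_pair_zero : fundamental_pair 0 (fun _ => 1) (fun x => x).
Proof.
  split; auto; intros; try ring; auto_derive; auto; ring.
Qed.

Lemma fundamental_pair_neg (w : R) : 0 < w ->
  fundamental_pair (- w ^ 2) (fun x => cosh (w * x)) (fun x => sinh (w * x) / w).
Proof.
  intros Hw; split.
  - rewrite Rmult_0_r; apply cosh_0.
  - rewrite Rmult_0_r, sinh_0; field; lra.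
  - intros x; unfold cosh, sinh; auto_derive; auto; field; lra.
  - intros x; unfold cosh, sinh; auto_derive; auto; field; lra.
  - intros x; pose proof (cosh_square (w * x)).
    transitivity (cosh (w * x) ^ 2 - sinh (w * x) ^ 2); [field; lra|lra].
Qed.

Lemma half_turn_decomposition (z : R) : 0 < z ->
  exists k w, (1 <= k)%nat /\ 0 <= w < PI /\ z = INR k * PI - w.
Proof.
  intros Hz; pose proof PI_RGT_0 as HPI.
  destruct (nfloor_ex (z / PI)) as [n [Hn1 Hn2]].
  { apply Rlt_le, Rdiv_lt_0_compat; lra. }
  assert (E : z = z / PI * PI) by (field; lra).
  destruct Hn1 as [Hn1|Hn1].
  - exists (S n), (INR (S n) * PI - z); repeat split; [lia| | |ring]; rewrite S_INR.
    + nra.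
    + nra.
  - exists n, 0; repeat split; try lra; [|rewrite Hn1; lra].
    destruct n; [|lia]; simpl in Hn1; rewrite <- Hn1 in E; lra.
Qed.

Lemma positive_characteristic_roots (z : R) : 0 < z ->
  cos z * (cos z + z * sin z) = 0 <-> exists i, z = node limit_phase (S i).
Proof.
  intros Hz; split.
  - intros E; pose proof PI_RGT_0 as HPI.
    destruct (half_turn_decomposition z Hz) as [k [w [Hk [Hw Ez]]]].
    destruct (cos_sin_half_turns k w) as [Ec Es]; rewrite <- Ez in Ec, Es.
    assert (Hs : (-1) ^ k <> 0) by (apply pow_nonzero; lra).
    apply Rmult_integral in E; destruct E as [E|E].
    + rewrite Ec in E; apply Rmult_integral in E; destruct E as [E|E]; [contradiction|].
      assert (w = PI / 2).
      { destruct (Rtotal_order w (PI / 2)) as [L|[L|L]]; auto.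
        - pose proof (cos_gt_0 w); lra.
        - pose proof (cos_lt_0 w); lra. }
      exists (2 * k - 2)%nat; unfold node.
      replace (S (2 * k - 2)) with (2 * (k - 1) + 1)%nat by lia.
      rewrite Nat.even_odd, plus_INR, mult_INR, minus_INR by lia; simpl; subst; field.
    + assert (E' : z * sin w = cos w).
      { apply Rmult_eq_reg_l with ((-1) ^ k); auto; rewrite Ec, Es in E; revert E; generalize ((-1) ^ k); intros; lra. }
      assert (w <> 0) by (intros ->; rewrite sin_0, cos_0 in E'; lra).
      assert (Hsin : 0 < sin w) by (apply sin_gt_0; lra).
      assert (Hcos : 0 < cos w) by (rewrite <- E'; apply Rmult_lt_0_compat; auto).
      assert (w < PI / 2).
      { destruct (Rtotal_order w (PI / 2)) as [L|[L|L]]; auto.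
        - rewrite L, cos_PI2 in Hcos; lra.
        - pose proof (cos_lt_0 w); lra. }
      assert (Ew : w = limit_phase k).
      { destruct (limit_phase_spec k Hk) as [Hl El]; rewrite Ez in E'.
        destruct (Rtotal_order w (limit_phase k)) as [L|[L|L]]; auto.
        - assert (F := phase_function_increasing k w (limit_phase k) Hk ltac:(lra) L ltac:(lra)); lra.
        - assert (F := phase_function_increasing k (limit_phase k) w Hk ltac:(lra) L ltac:(lra)); lra. }
      exists (2 * k - 1)%nat; unfold node.
      replace (S (2 * k - 1)) with (2 * k)%nat by lia.
      rewrite Nat.even_even, Nat.div2_double, mult_INR; simpl; rewrite Ez, Ew; field.
  - intros [i ->]; apply (node_equation (fun z => z)).
    intros E; apply limit_phase_spec; apply even_double in E; lia.
Qed.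

(** For l = (2 z)^2 the determinant is 4 cos z (cos z + z sin z), for l = 0 it is 4,
    and for l = - (2 x)^2 it is 4 cosh x (cosh x - x sinh x). *)
Lemma is_eigenvalue_iff_list (mu : R) :
  is_eigenvalue mu <-> exists i, eigenvalue_list i = mu.
Proof.
  destruct (Rtotal_order mu 0) as [L|[->|L]].
  - set (w := sqrt (- mu)).
    assert (Hw : 0 < w) by (apply sqrt_lt_R0; lra).
    assert (Emu : mu = - w ^ 2) by (unfold w; rewrite pow2_sqrt; lra).
    rewrite Emu, (eigenvalue_iff _ _ _ (fundamental_pair_neg w Hw)), Rmult_1_r.
    set (x := w / 2).
    replace w with (2 * x) by (unfold x; field).
    replace (2 + 2 * cosh (2 * x) + - (2 * x) ^ 2 * (sinh (2 * x) / (2 * x)))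
      with (4 * cosh x * (cosh x - x * sinh x)).
    2:{ rewrite sinh_double.
        replace (cosh (2 * x)) with (2 * cosh x ^ 2 - 1).
        2:{ replace (2 * x) with (x + x) by ring; rewrite cosh_plus.
            pose proof (cosh_square x); lra. }
        field; unfold x; lra. }
    assert (0 < cosh x) by (unfold cosh; pose proof (exp_pos x); pose proof (exp_pos (- x)); lra).
    destruct limit_hyp_root_spec as [H1 H2].
    split.
    + intros E; exists O; unfold eigenvalue_list.
      assert (x * sinh x - cosh x = 0).
      { apply Rmult_eq_reg_l with (4 * cosh x); lra. }
      replace x with limit_hyp_root; auto.
      destruct (Rtotal_order limit_hyp_root x) as [G|[G|G]]; auto.
      * assert (F := hyp_function_increasing limit_hyp_root x ltac:(lra) G); lra.
      * assert (F := hyp_function_increasing x limit_hyp_root ltac:(unfold x; lra) G); lra.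
    + intros [[|i] E].
      * assert (limit_hyp_root = x) by (unfold eigenvalue_list in E; unfold x in *; nra).
        rewrite <- H0, H2; ring.
      * pose proof (eigenvalue_list_pos i); nra.
  - rewrite (eigenvalue_iff _ _ _ fundamental_pair_zero); split.
    + intros; lra.
    + intros [i E]; destruct (eigenvalue_list_neq_0 i E).
  - set (w := sqrt mu).
    assert (Hw : 0 < w) by (apply sqrt_lt_R0; lra).
    assert (Emu : mu = w ^ 2) by (unfold w; rewrite pow2_sqrt; lra).
    rewrite Emu, (eigenvalue_iff _ _ _ (fundamental_pair_pos w Hw)), Rmult_1_r.
    set (z := w / 2); assert (Hz : 0 < z) by (unfold z; lra).
    replace w with (2 * z) by (unfold z; field).
    replace (2 + 2 * cos (2 * z) + (2 * z) ^ 2 * (sin (2 * z) / (2 * z)))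
      with (4 * (cos z * (cos z + z * sin z))).
    2:{ rewrite sin_2a, cos_2a_cos; field; lra. }
    transitivity (cos z * (cos z + z * sin z) = 0); [split; lra|].
    rewrite (positive_characteristic_roots z Hz); split.
    + intros [i ->]; exists (S i); reflexivity.
    + intros [[|i] E].
      * pose proof eigenvalue_list_neg; nra.
      * exists i; pose proof (limit_node_pos (S i) ltac:(lia)).
        unfold eigenvalue_list in E; nra.
Qed.

(** * The recursion *)

Lemma ex_series_eigen_abs (p : nat) : (1 <= p)%nat ->
  ex_series (fun i => Rabs (1 / eigenvalue_list i ^ p)).
Proof.
  intros Hp; apply ex_series_incr_1.
  apply ex_series_ext with (fun i => (/ eigenvalue_list (S i)) ^ p).
  - intros i; pose proof (eigenvalue_list_pos i) as H.
    rewrite Rabs_pos_eq.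
    + unfold Rdiv; rewrite Rmult_1_l, pow_inv; reflexivity.
    + apply Rlt_le, Rdiv_lt_0_compat; [lra|apply pow_lt; auto].
  - apply (ex_series_incr_1 (fun i => (/ eigenvalue_list i) ^ p)).
    apply power_sum_limit; auto.
Qed.

Lemma is_series_eigenvalues (lambda : nat -> R) (p : nat) :
  enumerates_eigenvalues lambda -> (1 <= p)%nat ->
  is_series (fun n => 1 / lambda n ^ p) (eigen_power_sum p).
Proof.
  intros [Hinj Hall] Hp.
  replace (eigen_power_sum p) with (Series (fun i => 1 / eigenvalue_list i ^ p)).
  2:{ apply Series_ext; intros; unfold Rdiv; rewrite Rmult_1_l, pow_inv; reflexivity. }
  apply (is_series_rearrange lambda eigenvalue_list (fun x => 1 / x ^ p)); auto.
  - apply eigenvalue_list_inj.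
  - intros i; apply Hall, is_eigenvalue_iff_list; eauto.
  - intros n; apply is_eigenvalue_iff_list, Hall; eauto.
  - apply ex_series_eigen_abs; auto.
Qed.

(* [sum_n_m a 1 (p - 1)] is the empty sum 0 when p = 1. *)
Theorem theorem3 (lambda : nat -> R) (hlambda : enumerates_eigenvalues lambda) :
  (forall p : nat, (1 <= p)%nat ->
     ex_series (fun n => 1 / lambda n ^ p) /\
     is_RInt (fun x => iter_kernel p x x) 0 1 (A lambda p)) /\
  A lambda 1 = 0 /\
  (forall p : nat, (1 <= p)%nat ->
     4 * A lambda (p + 1) +
     sum_n_m (fun k : nat =>
       (-1) ^ k
       * (2 / INR (fact (2 * k)) - 1 / INR (fact (2 * k - 1)))
       * A lambda (p - k + 1)) 1 (p - 1)
     = (-1) ^ (p + 1) * INR p / INR (fact (2 * p + 1))).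
Proof.
  assert (HA : forall p, (1 <= p)%nat -> A lambda p = eigen_power_sum p).
  { intros p Hp; apply is_series_unique, is_series_eigenvalues; auto. }
  assert (Hd1 : char_coef 1 = 0) by (unfold char_coef; simpl; field).
  assert (HA1 : A lambda 1 = 0).
  { rewrite HA by lia; pose proof (newton_sum_eigenvalues 0) as N.
    unfold newton_sum in N; rewrite sum_O, char_coef_0, Hd1 in N.
    rewrite Nat.sub_0_r in N; lra. }
  split; [|split; auto].
  - intros p Hp; split.
    + eexists; apply is_series_eigenvalues; eauto.
    + rewrite HA by auto.
      rewrite <- (newton_sum_inj char_coef trace eigen_power_sum); auto.
      * destruct p; [lia|]; apply is_RInt_trace.
      * rewrite char_coef_0; lra.
      * intros q; rewrite newton_sum_trace, newton_sum_eigenvalues; reflexivity.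
  - intros p Hp; destruct p as [|p]; [lia|].
    pose proof (newton_sum_eigenvalues (S p)) as N.
    rewrite newton_sum_split, char_coef_0 in N.
    rewrite sum_n_Sm in N by lia; unfold plus in N; simpl AbelianMonoid.sort in N.
    replace (S (S p) - S p)%nat with 1%nat in N by lia.
    rewrite <- !HA, HA1 in N by lia.
    replace (S p - 1)%nat with p by lia.
    replace (S p + 1)%nat with (S (S p)) by lia.
    rewrite (sum_n_m_ext_loc _ (fun k => 4 * (char_coef k * eigen_power_sum (S (S p) - k)))).
    2:{ intros k Hk; destruct k as [|k]; [lia|].
        rewrite <- char_coef_S, HA by lia.
        replace (S p - S k + 1)%nat with (S (S p) - S k)%nat by lia; eqR; ring. }
    rewrite (sum_n_m_mult_l (K := R_AbsRing) 4).
    match type of N with context [sum_n_m ?f 1 p] => set (Z := sum_n_m f 1 p) in * end.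
    change (4 * A lambda (S (S p)) + 4 * Z = (-1) ^ S (S p) * INR (S p) / INR (fact (2 * S p + 1))).
    transitivity (- INR (S (S p)) * (4 * char_coef (S (S p)))).
    { change (1 * A lambda (S (S p)) + (Z + char_coef (S p) * 0) = - INR (S (S p)) * char_coef (S (S p))) in N.
      lra. }
    rewrite char_coef_S.
    replace (2 * S (S p))%nat with (S (2 * S p + 1)) by lia.
    replace (S (2 * S p + 1) - 1)%nat with (2 * S p + 1)%nat by lia.
    rewrite INR_fact_S, (S_INR (S p)), plus_INR, mult_INR.
    pose proof (INR_fact_neq_0 (2 * S p + 1)); pose proof (pos_INR (S p)).
    simpl (INR 2); simpl (INR 1); field; split; lra || assumption.
Qed.
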